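(* The function $d:\mathbb R\to[0,1]$, $d(t)=HD(L\cap(-\infty,t))$, is not a Hölder continuous function (for any exponent $\alpha>0$).
   Context: $HD$ denotes Hausdorff dimension (the empty set has dimension $0$). For irrational $\alpha$, $k(\alpha):=\sup\{k>0 \mid |\alpha-\frac pq|<\frac{1}{kq^2} \text{ has infinitely many rational solutions } \frac pq\}\in(0,+\infty]$. The Lagrange spectrum is $L=\{k(\alpha)\mid \alpha\in\mathbb{R}\setminus\mathbb{Q},\ k(\alpha)<+\infty\}$. *)

(* Defs.v *)
From HB Require Import structures.
From mathcomp Require Import all_boot all_order all_algebra.
From mathcomp Require Import all_classical all_reals all_analysis.

Set Implicit Arguments.
Unset Strict Implicit.
Unset Printing Implicit Defensive.

Import Order.TTheory GRing.Theory Num.Theory.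

Local Open Scope classical_set_scope.
Local Open Scope ring_scope.

Section HausdorffDimension.
Context {R : realType}.
Implicit Types (A U : set R) (s delta : R).

(* The maximum with 0 only matters for set0, where ereal_sup is -oo. *)
Definition diam U : \bar R :=
  maxe 0%E (ereal_sup [set `|x - y|%:E | x in U & y in U]).

Definition hausdorff_content delta s A : \bar R :=
  ereal_inf [set (\sum_(0 <= n <oo) (diam (U n) `^ s))%E |
    U in [set U : (set R)^nat |
      A `<=` \bigcup_n U n /\ forall n, (diam (U n) <= delta%:E)%E]].

Definition hausdorff_measure s A : \bar R :=
  ereal_sup [set hausdorff_content delta s A |
    delta in [set delta : R | 0 < delta]].

(* Restricting to s > 0 avoids 0 `^ 0 and does not change the infimum, since
   the s-dimensional measure of A vanishes for all s > dim A.  In particular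
   the dimension of set0 is 0. *)
Definition hausdorff_dim A : \bar R :=
  ereal_inf [set s%:E | s in [set s : R | 0 < s /\ hausdorff_measure s A = 0%E]].

End HausdorffDimension.

Section LagrangeSpectrum.
Context {R : realType}.
Implicit Types (alpha t : R).

(* Solutions p/q are counted as rational numbers, q being the reduced
   denominator.  This is harmless: if the inequality holds for some
   representative of p/q then it holds for the reduced one. *)
Definition approx_constant alpha : \bar R :=
  ereal_sup [set k%:E | k in [set k : R | 0 < k /\
    infinite_set [set r : rat |
      `|alpha - ratr r| < 1 / (k * (denq r)%:~R ^+ 2)]]].

Definition lagrange_spectrum : set R :=
  [set l : R | exists2 alpha, irrational alpha & approx_constant alpha = l%:E].

Definition lagrange_dim t : \bar R :=
  hausdorff_dim (lagrange_spectrum `&` [set x : R | x < t]).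

End LagrangeSpectrum.

Definition holder_continuous {R : realType} (a : R) (f : R -> R) : Prop :=
  exists C : R, forall x y : R, `|f x - f y| <= C * `|x - y| `^ a.

(* Main.v *)
Require Import Defs.
From HB Require Import structures.
From mathcomp Require Import all_boot all_order all_algebra.
From mathcomp Require Import all_classical all_reals all_analysis.
From mathcomp Require Import zify ring lra.

(** The function [d] vanishes at [3] but [d (3 + 2 / 4 ^ m)] is at least
    [1 / (4 (m + 4))], so no Hölder estimate can hold at [3].

    [d 3 = 0]: if [k(x) < 3], the continued fraction of [x] is eventually
    periodic, so [L] has only countably many points below [3].  Indeed, since
    [[0; 1, 1 + s] = 1 - 1 / (2 + s)], the value of the expansion at a
    transition between [2 2] and [1 1] is [3 + 1 / (2 + r) - 1 / (2 + s)],
    where [r] and [s] are read outwards past [2 2] and past [1 1].  Values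
    bounded away from [3] thus force the two outward readings to differ within
    a bounded distance [N], in a prescribed direction.  This forces all runs to
    have even length, and the resulting word over [a = 22], [b = 11] cannot
    contain both [a a] and [b b] far out; hence it is the image of another word
    under [a |-> a, b |-> a b] (up to exchanging the letters), and that word
    has the same property with [N - 1] instead of [N].

    Lower bound: consider expansions made of blocks [2 2 1^(2 k)].  If [psi] is
    the value of [[0; 1, 1, 1, ...]], then [2 + 1 / (2 + psi) + psi = 3], and a
    target reading [w] that starts with the shortest run [1^(2 m)] followed by
    arbitrary runs [2 (m + 1)] or [2 (m + 2)] yields the point
    [2 + 1 / (2 + w) + psi] of [L]: repeat longer and longer prefixes of the
    target, each preceded by longer and longer runs of [1].  These points are
    indexed by binary expansions, and the dimension of the set that they form
    is bounded below by comparison with Lebesgue measure on [[0, 1[]. *)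

Set Implicit Arguments.
Unset Strict Implicit.
Unset Printing Implicit Defensive.

Import Order.TTheory GRing.Theory Num.Theory.

(** * Words with the Markov property *)

Ltac lia_no_bits := repeat match goal with
  | H : @eq bool _ _ |- _ => clear H
  | H : is_true (~~ (@eq_op _ ?b _)) |- _ =>
      let T := type of b in unify T bool; clear H
  end; lia.

Definition eventually_periodic (T : Type) (x : nat -> T) : Prop :=
  exists n p, 0 < p /\ forall i, n <= i -> x (i + p) = x i.

(* The letters are read outwards from a transition; [j.+1] and [j.+2] skip the
   two letters of the transition itself. *)
Definition markov (N n0 : nat) (x : nat -> bool) : Prop :=
  forall i, n0 <= i -> x i != x i.+1 ->
  exists2 d, d < N &
    [/\ forall j, j < d -> x (i - j.+1) = x (i + j.+2),
        x (i - d.+1) = x i.+1 & x (i + d.+2) = x i].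

Lemma eventually_constant_periodic (x : nat -> bool) n0 :
  (forall i, n0 <= i -> x i = x i.+1) -> eventually_periodic x.
Proof.
by move=> h; exists n0, 1; split=> // i ni; rewrite addn1 -h.
Qed.

Lemma markov_complement N n0 x : markov N n0 x -> markov N n0 (negb \o x).
Proof.
move=> mx i ni /= xi.
have [|d dN [e1 e2 e3]] := mx i ni; first by apply: contra xi => /eqP->.
exists d => //; split=> [j jd||]; [by rewrite e1|by rewrite e2|by rewrite e3].
Qed.

(** Descent on [q - p]. The Markov condition at the transition from [q - 1] to [q] reflects the
    letters left of [q] to its right, and the reflection contains a strictly shorter bridge starting
    at [q]. *)
Lemma markov_no_alternating_bridge N n0 x : markov N n0 x ->
  forall p q, n0 + N < p -> p < q -> x p = x p.+1 -> x q = x q.+1 -> x p != x q ->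
  (forall i, p < i < q -> x i != x i.+1) -> False.
Proof.
move=> mx p q np; have [l] := ubnP (q - p).
elim: l p q np => // l IH p q np ql pq xp xq xpq alt.
have pq2 : p + 2 <= q.
  case: (ltngtP (p + 1) q) => [|| e]; [lia_no_bits|lia_no_bits|].
  by move: xpq; rewrite -e addn1 -xp eqxx.
have hq : x q.-1 != x q.
  case: (ltngtP (p + 1) q.-1) => [h||e]; [|lia_no_bits|].
  - by have := alt q.-1; rewrite (ltn_predK pq); apply; lia_no_bits.
  - by move: xpq; rewrite xp -e addn1.
have [||d dN [e1 e2 e3]] := mx q.-1; [lia_no_bits|by rewrite (ltn_predK pq)|].
rewrite (ltn_predK pq) in e2.
have Sd : x (q + d.+1) = x q.-1 by rewrite -e3; congr x; lia_no_bits.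
have RS j : j < d -> x (q + j.+1) = x (q - j.+2).
  move=> /e1 h; have -> : q - j.+2 = q.-1 - j.+1 by lia_no_bits.
  by rewrite h; congr x; lia_no_bits.
have Rd : x (q - d.+2) = x q by rewrite -e2; congr x; lia_no_bits.
have d0 : 0 < d.
  by case: (posnP d) Sd hq => // ->; rewrite addn1 -xq => ->; rewrite eqxx.
have S0 := RS 0 d0.
(* The letters to the right of q mirror those to its left, which yields a
   shorter bridge between q and some q'. *)
have [q' [q1 q2 q3 q4 q5]] : exists q', [/\ q < q', q' - q < q - p,
    x q' = x q'.+1, x q != x q' & forall i, q < i < q' -> x i != x i.+1].
  case: (leqP (d + p + 3) q) => dpq.
  (* The reflection breaks inside the alternating stretch, so the letter at [q + d + 1] repeats the
     one at [q + d]. *)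
  - exists (q + d); split; [lia_no_bits|lia_no_bits| | |].
    + rewrite -addnS Sd; have -> : q + d = q + d.-1.+1 by lia_no_bits.
      rewrite RS; last lia_no_bits.
      have h : p < q - d.+2 < q by lia_no_bits.
      have := alt (q - d.+2) h; rewrite Rd.
      have -> : (q - d.+2).+1 = q - d.-1.+2 by lia_no_bits.
      move: hq.
      by case: (x q); case: (x q.-1); case: (x _).
    + have := alt (q - d.+2); rewrite Rd.
      have -> : (q - d.+2).+1 = q - d.-1.+2 by lia_no_bits.
      rewrite -RS; last lia_no_bits.
      have -> : q + d.-1.+1 = q + d by lia_no_bits.
      by apply; lia_no_bits.
    + move=> i hi; have -> : i = q + (i - q).-1.+1 by lia_no_bits.
      rewrite -addnS !RS; [|lia_no_bits|lia_no_bits].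
      rewrite eq_sym.
      have := alt (q - (i - q).-1.+3).
      have -> : (q - (i - q).-1.+3).+1 = q - (i - q).-1.+2 by lia_no_bits.
      by apply; lia_no_bits.
  (* The reflection cannot break exactly at [p], because [x p != x q]. Hence it includes [p], and
     the square at [p] reappears to the right of [q]. *)
  - have dp : q - p.+2 != d.
      apply/eqP => e; move: Rd; have -> : q - d.+2 = p by lia_no_bits.
      by move=> e'; rewrite e' eqxx in xpq.
    have xS : x (q + (q - p).-1) = x p.
      have -> : q + (q - p).-1 = q + (q - p.+2).+1 by lia_no_bits.
      rewrite RS; last lia_no_bits.
      by congr x; lia_no_bits.
    have q3 : q != p.+2.
      apply/eqP=> e; have h : (q - p).-1 = 1 by lia_no_bits.
      by move: xpq; rewrite -xS h addn1 -xq eqxx.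
    have xS' : x (q + (q - p).-2) = x p.+1.
      have -> : q + (q - p).-2 = q + (q - p - 3).+1 by lia_no_bits.
      rewrite RS; last lia_no_bits.
      by congr x; lia_no_bits.
    exists (q + (q - p).-2); split; [lia_no_bits|lia_no_bits| | |].
    + by rewrite xS' -xp -xS; congr x; lia_no_bits.
    + by rewrite xS' -xp eq_sym.
    + move=> i hi; have -> : i = q + (i - q).-1.+1 by lia_no_bits.
      rewrite -addnS !RS; [|lia_no_bits|lia_no_bits].
      rewrite eq_sym.
      have := alt (q - (i - q).-1.+3).
      have -> : (q - (i - q).-1.+3).+1 = q - (i - q).-1.+2 by lia_no_bits.
      by apply; lia_no_bits.
by apply: (IH q q' _ _ q1 xq q3 q4 q5); lia_no_bits.
Qed.


(** By induction on the distance, a square strictly between [p] and [q] would share its letter with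
    both. So the word between them alternates, and the squares are joined by a forbidden bridge. *)
Lemma markov_no_square_both N n0 x : markov N n0 x ->
  forall p q, n0 + N < p -> p < q -> x p = x p.+1 -> x q = x q.+1 -> x p = x q.
Proof.
move=> mx p q np; have [l] := ubnP (q - p).
elim: l p q np => // l IH p q np ql pq xp xq; apply/eqP/negPn/negP => xpq.
apply: (markov_no_alternating_bridge mx np pq xp xq xpq) => i hi.
apply/negP => /eqP xi.
have h1 := IH p i np ltac:(lia_no_bits) ltac:(lia_no_bits) xp xi.
have h2 := IH i q ltac:(lia_no_bits) ltac:(lia_no_bits) ltac:(lia_no_bits) xi xq.
by rewrite h1 h2 eqxx in xpq.
Qed.

Lemma eventually_no_square N n0 x : markov N n0 x ->
  exists c, exists m, forall i, m <= i -> ~~ ((x i == c) && (x i.+1 == c)).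
Proof.
have [[p np xp]|h] := pselect (exists2 p, n0 + N < p & x p = x p.+1) => mx.
- exists (~~ x p), p.+1 => i pi; apply/negP => /andP[/eqP xi /eqP xi1].
  have := markov_no_square_both mx np pi xp; rewrite xi xi1 => /(_ erefl).
  by case: (x p).
- exists true, (n0 + N).+1 => i ni; apply/negP => /andP[/eqP xi /eqP xi1].
  by apply: h; exists i; rewrite // xi xi1.
Qed.

(** * Desubstitution of binary words *)

(* The desubstitution of x by false |-> false, true |-> (false true), reading
   from position t: block n starts at [block_start n] and is long when
   [x (block_start n).+1]. *)
Fixpoint block_start (x : nat -> bool) (t n : nat) : nat :=
  if n is n'.+1 then
    let p := block_start x t n' in if x p.+1 then p.+2 else p.+1
  else t.

Section Desubstitution.
Variables (x : nat -> bool) (t : nat).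
Hypothesis xt : x t = false.
Hypothesis no_square : forall i, t <= i -> ~~ (x i && x i.+1).
Let pos := block_start x t.
Let y n := x (pos n).+1.

Lemma block_startS n : pos n.+1 = if y n then (pos n).+2 else (pos n).+1.
Proof. by []. Qed.

Lemma block_start_ge n : t + n <= pos n.
Proof.
elim: n => [|n]; first by rewrite addn0.
by rewrite block_startS; case: (y n) => ?; lia_no_bits.
Qed.

Lemma block_start_false n : x (pos n) = false.
Proof.
elim: n => [|n IH] //; rewrite block_startS; case E: (y n) => //.
have := no_square (i := (pos n).+1); rewrite -/(y n) E /= => /(_ _)/negbTE; apply.
by have := block_start_ge n; lia_no_bits.
Qed.

Lemma block_start_last n : x (pos n.+1).-1 = y n.
Proof.
by rewrite block_startS; case E: (y n) => //=; rewrite block_start_false.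
Qed.

(** A block followed by the initial [false] of the next one is a palindrome, so equal blocks give
    equal letters in both reading directions. The shared boundary letter explains [j <= l]. *)
Lemma block_start_mirror u v d : d <= u ->
  (forall j, j < d -> y (u - j.+1) = y (v + j)) ->
  exists2 l, d <= l & [/\ pos (u - d) + l = pos u, pos (v + d) = pos v + l &
    forall j, j <= l -> x (pos u - j) = x (pos v + j)].
Proof.
elim: d => [|d IH] du yuv.
  exists 0 => //; split; rewrite ?subn0 ?addn0 // => j.
  by rewrite leqn0 => /eqP->; rewrite subn0 addn0 !block_start_false.
have [|j jd|l dl [pu pv xl]] := IH; [lia_no_bits|apply: yuv; lia_no_bits|].
have yd := yuv d (leqnn _); set w := u - d.+1 in yd *.
have wu : u - d = w.+1 by rewrite /w; lia_no_bits.
rewrite wu in pu; have xw := block_start_false w.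
have xv := block_start_false (v + d).+1.
have e1 := block_startS w; have e2 := block_startS (v + d).
rewrite addnS; case E: (y w) e1 e2 yd => e1 e2 /esym yd; rewrite yd in e2.
- exists l.+2; [lia_no_bits|split; [lia_no_bits|lia_no_bits|]] => j.
  rewrite leq_eqVlt => /orP[/eqP->|].
    have -> : pos u - l.+2 = pos w by lia_no_bits.
    have -> : pos v + l.+2 = pos (v + d).+1 by lia_no_bits.
    by rewrite xw xv.
  rewrite ltnS leq_eqVlt => /orP[/eqP->|]; last exact: xl.
  have -> : pos u - l.+1 = (pos w).+1 by lia_no_bits.
  have -> : pos v + l.+1 = (pos (v + d)).+1 by lia_no_bits.
  by rewrite -/(y _) -/(y _) E yd.
- exists l.+1; [lia_no_bits|split; [lia_no_bits|lia_no_bits|]] => j.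
  rewrite leq_eqVlt => /orP[/eqP->|]; last exact: xl.
  have -> : pos u - l.+1 = pos w by lia_no_bits.
  have -> : pos v + l.+1 = pos (v + d).+1 by lia_no_bits.
  by rewrite xw xv.
Qed.

(** Two different consecutive blocks have three letters in all, the last two being [y i] and
    [y i.+1], so a transition of [y] is one of [x]. Both outward readings of [x] then start with
    [false], an agreement invisible in [y]; this is why [N] drops by one. *)
Lemma markov_desubstitution N n0 : n0 <= t -> markov N.+1 n0 x -> markov N N y.
Proof.
move=> n0t mx i Ni yi; set P := pos i.
have [x1 x2 pos2] : [/\ x P.+1 = y i, x P.+2 = y i.+1 & pos i.+2 = P.+3].
  have e1 := block_startS i; have e2 := block_startS i.+1.
  have e3 := block_start_false i.+1.
  move: yi; case E: (y i) e1 => e1; rewrite e1 in e2 e3;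
    case E' : (y i.+1) e2 => // e2 _; split=> //.
  by rewrite -E' /y e1.
have nP : n0 <= P.+1 by have := block_start_ge i; rewrite -/P; lia_no_bits.
have [|d dN [a1 a2 a3]] := mx P.+1 nP; first by rewrite x1 x2.
rewrite x2 subSS in a2.
have {}a3 : x (P.+3 + d) = y i by rewrite -x1 -a3; congr x; lia_no_bits.
have xd : x (P - d) != x (pos i.+2 + d) by rewrite pos2 a2 a3 eq_sym.
(* If [N] blocks agreed, more than [N] letters would agree, contrary to the difference at distance
   [d <= N]. *)
have [yN|] := pselect (forall j, j < N -> y (i - j.+1) = y (i.+2 + j)).
  have [l Nl [_ _ xl]] := block_start_mirror Ni yN.
  by rewrite xl ?eqxx // in xd; lia_no_bits.
move=> /existsNP[j0 /not_implyP[j0N /eqP yj0]].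
have [|d' /andP[d'N yd' d'min]] := ex_minnP (P := fun j => (j < N) && (y (i - j.+1) != y (i.+2 + j))).
  by exists j0; rewrite j0N.
have [||l d'l [pu pv xl]] := @block_start_mirror i i.+2 d'.
- lia_no_bits.
- move=> j jd'; apply/eqP/negPn/negP => yj.
  have := d'min j; rewrite yj andbT => /(_ ltac:(lia_no_bits)).
  by lia_no_bits.
have ld : l < d by rewrite ltnNge; apply/negP => dl; rewrite xl ?eqxx in xd.
have wi : i - d' = (i - d'.+1).+1 by lia_no_bits.
have L : x (P - l.+1) = y (i - d'.+1).
  by rewrite -block_start_last -wi; congr x; lia_no_bits.
have S : x (pos i.+2 + l.+1) = y (i.+2 + d') by rewrite /y pv addnS.
(* After the common letters come the last letter of a block on the left and the letter after a block
   start on the right. Both are values of [y], so the first difference of letters is the first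
   difference of blocks. *)
have dl : d = l.+1.
  apply/eqP; rewrite eqn_leq ld andbT leqNgt; apply/negP => ld'.
  move: yd'; rewrite -L -S pos2 -[P - _]subSS a1 //.
  by rewrite (_ : P.+1 + l.+3 = P.+3 + l.+1) ?eqxx //; lia_no_bits.
exists d' => //; split.
- move=> j jd'; rewrite -2!addSnnS; apply/eqP/negPn/negP => yj.
  have := d'min j; rewrite yj andbT => /(_ ltac:(lia_no_bits)).
  by lia_no_bits.
- by rewrite -L -dl.
- by rewrite -addSnnS -addSnnS -S -dl pos2 -a3; congr x; lia_no_bits.
Qed.

(** Any [p] consecutive blocks from block [n] on have the same total length, which becomes the
    period of [x]. *)
Lemma eventually_periodic_substitution :
  eventually_periodic y -> eventually_periodic x.
Proof.
move=> [n [p [p0 yp]]].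
have posp k : pos (n + k + p) + pos n = pos (n + k) + pos (n + p).
  elim: k => [|k IH]; first by rewrite addn0 addnC.
  rewrite addnS addSn !block_startS yp ?leq_addr //; case: (y _); lia_no_bits.
have posn k : k <= pos k by have := block_start_ge k; lia_no_bits.
have posD u v : u <= v -> pos u + (v - u) <= pos v.
  move=> /subnK <-; elim: (v - u) => [|w IH]; first by rewrite add0n; lia_no_bits.
  by rewrite addSn block_startS; case: (y _); lia_no_bits.
have cover i : pos n <= i -> exists k, i = pos (n + k) \/ (i = (pos (n + k)).+1 /\ y (n + k)).
  move=> /subnK <-; elim: (i - pos n) => [|w [k [e|[e yk]]]].
  - by exists 0; left; rewrite addn0.
  - case E: (y (n + k)); first by exists k; right; split=> //; lia_no_bits.
    by exists k.+1; left; rewrite addnS block_startS E; lia_no_bits.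
  - by exists k.+1; left; rewrite addnS block_startS yk; lia_no_bits.
have D := posD n (n + p) (leq_addr _ _).
exists (pos n), (pos (n + p) - pos n); split; first by lia_no_bits.
move=> i /cover[k]; have pk := posp k.
have nk : n <= n + k by lia_no_bits.
case=> [->|[-> _]].
- have -> : pos (n + k) + (pos (n + p) - pos n) = pos (n + k + p) by lia_no_bits.
  by rewrite !block_start_false.
- have -> : (pos (n + k)).+1 + (pos (n + p) - pos n) = (pos (n + k + p)).+1 by lia_no_bits.
  exact: yp.
Qed.

End Desubstitution.

Lemma eventually_periodic_complement (x : nat -> bool) :
  eventually_periodic (negb \o x) -> eventually_periodic x.
Proof.
move=> [n [p [p0 h]]]; exists n, p; split=> // i ni.
by apply: negb_inj; exact: h.
Qed.

Theorem markov_eventually_periodic N n0 x : markov N n0 x -> eventually_periodic x.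
Proof.
elim: N n0 x => [|N IH] n0 x mx.
  apply: (@eventually_constant_periodic _ n0) => i ni; apply/eqP/negPn/negP => xi.
  by have [] := mx i ni xi.
have [c [m hc]] := eventually_no_square mx.
wlog ct : c x mx hc / c = true.
  move=> wl; case: c hc => hc; first exact: (wl true).
  apply: eventually_periodic_complement; apply: (wl true) => //.
  - exact: markov_complement.
  - by move=> i /hc /=; case: (x i); case: (x i.+1).
have {}hc i : maxn n0 m <= i -> ~~ (x i && x i.+1).
  by move=> mi; have := hc i ltac:(lia_no_bits); rewrite ct !eqb_id.
have [t mt xt] : exists2 t, maxn n0 m <= t & x t = false.
  have := hc (maxn n0 m) (leqnn _); case E: (x (maxn n0 m)) => /=; last by exists (maxn n0 m).
  by move=> /negbTE; exists (maxn n0 m).+1.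
have nsq i : t <= i -> ~~ (x i && x i.+1) by move=> ti; apply: hc; lia_no_bits.
apply: (eventually_periodic_substitution xt nsq); apply: IH.
by apply: (markov_desubstitution xt nsq (n0 := n0)) => //; lia_no_bits.
Qed.

(** * Words of digits and the parity of their runs *)

(** In the application [true] stands for the digit 2. The parity of [d] enters because the order of
    continued fractions reverses with each further digit. *)
Definition digit_markov (N n0 : nat) (x : nat -> bool) : Prop :=
  forall i, n0 <= i -> x i != x i.+1 ->
  [/\ x i.-1 = x i, x i.+2 = x i.+1 &
    exists2 d, d < N &
    [/\ forall j, j < d -> x (i - j.+2) = x (i + j.+3),
        x (i - d.+2) != x (i + d.+3) & (x (i - d.+2) == x i.+1) = ~~ odd d]].

(* An odd run is followed by a run of length two and then by a shorter odd run. *)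
Lemma digit_markov_even_run N n0 x : digit_markov N n0 x ->
  forall i j, n0 <= i -> i < j -> x i != x i.+1 -> x j != x j.+1 ->
  (forall k, i < k <= j -> x k = x j) -> ~~ odd (j - i).
Proof.
move=> mx i j; have [l] := ubnP (j - i).
elim: l i j => // l IH i j jil ni ij xi xj xij; apply/negP => oji.
have [e1 e2 [d dN [a1 a2 a3]]] := mx j ltac:(lia_no_bits) xj.
have xi1 : x i.+1 = x j by apply: xij; lia_no_bits.
have xin : x i = ~~ x j by rewrite -xi1; move: xi; case: (x i); case: (x i.+1).
have xjn : x j.+1 = ~~ x j by move: xj; case: (x j); case: (x j.+1).
have n3 : i + 3 <= j.
  have [ji|//] : j = i.+1 \/ i + 3 <= j.
    have ji2 : j - i <> 2 by move=> e; rewrite e in oji.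
    by lia_no_bits.
  by have [_ h2 _] := mx i ni xi; rewrite ji h2 eqxx in xj.
have Rc u : u.+2 < j - i -> x (j - u.+2) = x j by move=> h; apply: xij; lia_no_bits.
have Rn : x (j - (j - i - 2).+2) = ~~ x j by rewrite -xin; congr x; lia_no_bits.
(* [e] is the length of the run starting at [j + 3]. It is [d] if the readings part inside the run
   on the left, and [j - i - 2] if they part beyond it; parting exactly at [i] contradicts the
   parity clause. *)
have [e [ed oe Sc Se]] : exists e, [/\ e.+2 <= j - i, odd e,
    forall u, u < e -> x (j + u.+3) = x j & x (j + e.+3) = ~~ x j].
  case: (ltngtP d (j - i - 2)) => dn.
  - exists d; split; first lia_no_bits.
    + by move: a3; rewrite xjn Rc; [case: (x j); case: (odd d)|lia_no_bits].
    + by move=> u ud; rewrite -a1 // Rc //; lia_no_bits.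
    + by move: a2; rewrite Rc; [case: (x j); case: (x (j + _))|lia_no_bits].
  - exists (j - i - 2); split; [lia_no_bits| | |].
    + by rewrite oddB ?oji //; lia_no_bits.
    + by move=> u ud; rewrite -a1 ?Rc //; lia_no_bits.
    + by rewrite -a1 ?Rn //; lia_no_bits.
  - move: a3; rewrite dn Rn xjn eqxx oddB; last lia_no_bits.
    by rewrite oji.
have e0 : 0 < e by case: e oe {ed Sc Se}.
have xj3 : x j.+3 = x j by rewrite -addn3 Sc.
have xje : x (j.+2 + e) = x j by rewrite -(Sc e.-1); [congr x|]; lia_no_bits.
suff : ~~ odd (j.+2 + e - j.+2) by rewrite addKn oe.
apply: IH; [lia_no_bits|lia_no_bits|lia_no_bits| | |].
- by rewrite e2 xj3 eq_sym.
- rewrite xje (_ : (j.+2 + e).+1 = j + e.+3) ?Se; [by case: (x j)|lia_no_bits].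
- move=> k kj; rewrite xje -(Sc (k - j.+3)); [congr x|]; lia_no_bits.
Qed.

Theorem digit_markov_eventually_periodic N n0 x :
  digit_markov N n0 x -> eventually_periodic x.
Proof.
move=> mx.
have [[t0 nt0 xt0]|hx] := pselect (exists2 t, n0 <= t & x t != x t.+1); last first.
  apply: (@eventually_constant_periodic _ n0) => i ni.
  by apply/eqP/negPn/negP => xi; apply: hx; exists i.
set t := t0.+1.
(* If a transition split a pair, the preceding transition would end a pair by induction, so the run
   between the two would be odd. *)
have pairs n : x (t + n.*2) = x (t + n.*2).+1.
  have [l] := ubnP n; elim: l n => // l IH n nl.
  apply/eqP/negPn/negP => xj; set j := t + n.*2 in xj *.
  pose P i := (t0 <= i < j) && (x i != x i.+1).
  have exP : exists i, P i by exists t0; rewrite /P xt0 andbT /j /t; lia_no_bits.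
  have leP i : P i -> i <= j by move=> /andP[/andP[_ /ltnW]].
  have [i /andP[ti xi] imax] := ex_maxnP exP leP.
  have xij w : i + w < j -> x (j - w) = x j.
    elim: w => [|w IHw] iw; first by rewrite subn0.
    rewrite -IHw; last by lia_no_bits.
    have -> : j - w = (j - w.+1).+1 by lia_no_bits.
    apply/eqP/negPn/negP => xw.
    by have := imax (j - w.+1); rewrite /P xw andbT => /(_ ltac:(lia_no_bits)); lia_no_bits.
  have := digit_markov_even_run mx _ _ xi xj.
  have [ui iu] : exists u, i.+1 = t + u.*2.
    have [u [iu|iu]] : exists u, i.+1 = t + u.*2 \/ i.+1 = t + u.*2.+1.
      by exists ((i - t0)./2); have := odd_double_half (i - t0); case: (odd _); lia_no_bits.
    - by exists u.
    - have := IH u ltac:(lia_no_bits); rewrite (_ : t + u.*2 = i); last by lia_no_bits.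
      by move=> e; rewrite e eqxx in xi.
  have -> : odd (j - i) by rewrite (_ : j - i = (n - ui).*2.+1) /= ?odd_double; lia_no_bits.
  move=> /(_ ltac:(lia_no_bits) ltac:(lia_no_bits)) h; have // : false; apply: h => k ik.
  by rewrite -(subKn (_ : k <= j)) ?xij; lia_no_bits.
set y := fun n => x (t + n.*2).
have pe n : x (t + n.*2) = y n by [].
have po n : x (t + n.*2).+1 = y n by rewrite -pairs.
have ev_y : eventually_periodic y.
  apply: (@markov_eventually_periodic N N) => n Nn yn.
  have [||_ _ [d dN [a1 a2 a3]]] := mx (t + n.*2).+1; first by lia_no_bits.
    by rewrite po (_ : (t + n.*2).+2 = t + n.+1.*2) ?pe //; lia_no_bits.
  rewrite (_ : (t + n.*2).+2 = t + n.+1.*2) ?pe in a3; last by lia_no_bits.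
  have R0 u : u < n -> x ((t + n.*2).+1 - u.*2.+2) = y (n - u.+1).
    by move=> un; rewrite -po; congr x; lia_no_bits.
  have R1 u : u < n -> x ((t + n.*2).+1 - u.*2.+3) = y (n - u.+1).
    by move=> un; rewrite -pe; congr x; lia_no_bits.
  have S0 u : x ((t + n.*2).+1 + u.*2.+3) = y (n + u.+2).
    by rewrite -pe; congr x; lia_no_bits.
  have S1 u : x ((t + n.*2).+1 + u.*2.+4) = y (n + u.+2).
    by rewrite -po; congr x; lia_no_bits.
  (* An odd [d] would separate the second members of two pairs whose first members agree. So [d] is
     even, and the parity clause gives the direction required by [markov]. *)
  have := odd_double_half d; set e := d./2; case od: (odd d) => de.
    have := a1 e.*2 ltac:(lia_no_bits); rewrite R0 ?S0; last by lia_no_bits.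
    by move: a2; rewrite -de add1n R1 ?S1; [move=> + h; rewrite h eqxx|lia_no_bits].
  rewrite add0n in de; rewrite -de R0 ?S0 in a2; last by lia_no_bits.
  rewrite od -de R0 in a3; last by lia_no_bits.
  exists e; [lia_no_bits|split].
  - move=> j je; rewrite -R0 -?S0; last by lia_no_bits.
    by apply: a1; lia_no_bits.
  - exact/eqP.
  - move: a2 yn; rewrite (eqP a3).
    by case: (y n.+1); case: (y n); case: (y _).
have [n [p [p0 yp]]] := ev_y.
exists (t + n.*2), p.*2; split; first by lia_no_bits.
move=> i ti.
have [u [iu|iu]] : exists u, i = t + u.*2 \/ i = (t + u.*2).+1.
  by exists ((i - t)./2); have := odd_double_half (i - t); case: (odd _); lia_no_bits.
- by rewrite iu (_ : t + u.*2 + p.*2 = t + (u + p).*2) ?pe ?yp //; lia_no_bits.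
- by rewrite iu (_ : (t + u.*2).+1 + p.*2 = (t + (u + p).*2).+1) ?po ?yp //; lia_no_bits.
Qed.

Local Open Scope classical_set_scope.
Local Open Scope ring_scope.

(** * Continued fractions *)

(** [al n] is the [n]-th complete quotient of [al 0]. The condition [1 < al n.+1] forces all digits
    after the first to be positive. *)
Definition cf_expansion (R : realType) (a : nat -> int) (al : nat -> R) : Prop :=
  forall n, al n = (a n)%:~R + (al n.+1)^-1 /\ 1 < al n.+1.

Fixpoint cf_pair (a : nat -> int) (c : int * int) (n : nat) : int * int :=
  if n is n'.+1 then
    let c' := cf_pair a c n' in (c'.2, a n * c'.2 + c'.1)
  else c.

(* Indices are shifted by one: the n-th convergent is
   cf_num a n.+1 / cf_den a n.+1, and cf_num a 0 / cf_den a 0 is 1/0. *)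
Definition cf_num (a : nat -> int) n := (cf_pair a (1, a 0%N) n).1.
Definition cf_den (a : nat -> int) n := (cf_pair a (0, 1) n).1.

(* The backward continued fraction [0; a_n, ..., a_1]. *)
Fixpoint cf_back (R : realType) (a : nat -> int) (n : nat) : R :=
  if n is n'.+1 then ((a n)%:~R + cf_back R a n')^-1 else 0.

Section ContinuedFractions.
Variables (R : realType) (a : nat -> int) (al : nat -> R).
Hypothesis cf : cf_expansion a al.

Local Notation P := (cf_num a).
Local Notation Q := (cf_den a).
Local Notation x := (al 0%N).
Local Notation beta := (cf_back R a).
Let lam n := al n.+1 + beta n.

Lemma cf_numSS n : P n.+2 = a n.+1 * P n.+1 + P n. Proof. by []. Qed.
Lemma cf_denSS n : Q n.+2 = a n.+1 * Q n.+1 + Q n. Proof. by []. Qed.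

Lemma cf_gt1 n : 1 < al n.+1. Proof. by case: (cf n). Qed.

Lemma cf_digitS_ge1 n : 1 <= a n.+1.
Proof.
have [e h] := cf n.+1; have := cf_gt1 n; rewrite e.
have h1 : (al n.+2)^-1 < 1 by rewrite invf_lt1 ?(lt_trans ltr01).
move=> h2; have : (0 : R) < (a n.+1)%:~R by lra.
by rewrite ltr0z; lia.
Qed.

Lemma cf_den_gt0 n : 0 <= Q n /\ 0 < Q n.+1.
Proof.
elim: n => [|n [IH1 IH2]]; first by [].
have h := cf_digitS_ge1 n; have eQ := cf_denSS n.
by split; nia.
Qed.

Lemma cf_den_mono n : Q n.+1 + Q n <= Q n.+2.
Proof.
have h := cf_digitS_ge1 n; have eQ := cf_denSS n.
by have [h1 h2] := cf_den_gt0 n; nia.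
Qed.

Lemma cf_den_ge n : n%:Z <= Q n.+1.
Proof.
elim: n => [|[|n] IH]; [by []|by have := cf_den_mono 0|].
by have := cf_den_mono n.+1; have := cf_den_gt0 n; lia.
Qed.

Lemma cf_den_between d : 1 <= d -> exists n, Q n.+1 <= d < Q n.+2.
Proof.
move=> d1.
have exP : exists n, d < Q n.+1 by exists (absz d).+1; have := cf_den_ge (absz d).+1; lia.
case: (ex_minnP exP) => [[|n] dn nmin]; first by move: dn; rewrite /cf_den /=; lia.
exists n; rewrite dn andbT leNgt; apply/negP => /nmin; lia.
Qed.

Lemma cf_det n : P n.+1 * Q n - P n * Q n.+1 = (-1) ^+ n.+1.
Proof.
elim: n => [|n IH]; first by rewrite /cf_num /cf_den /=; ring.
rewrite exprS -IH cf_numSS cf_denSS; ring.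
Qed.

Let p n : R := (P n)%:~R.
Let q n : R := (Q n)%:~R.
Let D n : R := q n * x - p n.

Let pSS n : p n.+2 = (a n.+1)%:~R * p n.+1 + p n.
Proof. by rewrite /p cf_numSS rmorphD rmorphM. Qed.
Let qSS n : q n.+2 = (a n.+1)%:~R * q n.+1 + q n.
Proof. by rewrite /q cf_denSS rmorphD rmorphM. Qed.
Let q_ge0 n : 0 <= q n. Proof. by rewrite ler0z; case: (cf_den_gt0 n). Qed.
Let q_ge1 n : 1 <= q n.+1.
Proof. by rewrite ler1z; case: (cf_den_gt0 n) => _; lia. Qed.
Let al_gt1 n : 1 < al n.+1 := cf_gt1 n.
Let al_neq0 n : al n.+1 != 0. Proof. by have := al_gt1 n; lra. Qed.

Let cf_value n : x * (al n.+1 * q n.+1 + q n) = al n.+1 * p n.+1 + p n.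
Proof.
elim: n => [|n IH].
  have [q0 q1 p0 p1] : [/\ q 0 = 0, q 1 = 1, p 0 = 1 & p 1 = (a 0)%:~R] by [].
  rewrite q0 q1 p0 p1 (cf 0).1; field; exact: al_neq0.
have e : al n.+1 * al n.+2 = (a n.+1)%:~R * al n.+2 + 1.
  by rewrite {1}(cf n.+1).1 mulrDl mulVf ?al_neq0.
rewrite pSS qSS.
transitivity (x * (al n.+1 * al n.+2 * q n.+1 + al n.+2 * q n)); first by rewrite e; ring.
transitivity (al n.+1 * al n.+2 * p n.+1 + al n.+2 * p n); last by rewrite e; ring.
transitivity (al n.+2 * (x * (al n.+1 * q n.+1 + q n))); first by ring.
by rewrite IH; ring.
Qed.

Let cf_backE n : q n = beta n * q n.+1 /\ 0 <= beta n <= 1.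
Proof.
elim: n => [|n [IH1 IH2]]; first by rewrite (_ : q 0 = 0) //= mul0r lexx ler01.
have h : (1 : R) <= (a n.+1)%:~R by rewrite ler1z cf_digitS_ge1.
have h2 : (a n.+1)%:~R + beta n != 0 by lra.
split; last by rewrite /= invr_ge0 invf_le1; lra.
by rewrite qSS IH1 /=; field.
Qed.

Lemma cf_back_bounds n : 0 <= beta n <= 1.
Proof. by case: (cf_backE n). Qed.

Let lam_gt1 n : 1 < lam n.
Proof. by rewrite /lam; have := al_gt1 n; have := cf_back_bounds n; lra. Qed.

Let defectE n : D n.+1 * (lam n * q n.+1) = (-1) ^+ n.
Proof.
rewrite /lam [(_ + beta n) * _]mulrDl -(cf_backE n).1 /D mulrBl.
transitivity (q n.+1 * (x * (al n.+1 * q n.+1 + q n)) -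
   p n.+1 * (al n.+1 * q n.+1 + q n)); first by ring.
rewrite cf_value.
transitivity (- (p n.+1 * q n - p n * q n.+1)); first by ring.
by rewrite /p /q -!rmorphM -rmorphB cf_det rmorphXn rmorphN1 exprS mulN1r opprK.
Qed.

(** This identifies [lam n] as the constant realised by the [n]-th convergent. It follows from
    [defectE], a form of the determinant identity. *)
Lemma cf_approx n : `|x - p n.+1 / q n.+1| = 1 / (lam n * q n.+1 ^+ 2).
Proof.
have q0 := q_ge1 n; have l0 := lam_gt1 n.
have -> : x - p n.+1 / q n.+1 = (-1) ^+ n / (lam n * q n.+1 ^+ 2).
  by rewrite -defectE /D; field; apply/andP; split; lra.
rewrite normrM normrX normrN1 expr1n ger0_norm // invr_ge0 mulr_ge0 ?sqr_ge0 //; lra.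
Qed.

Definition cf_conv n : rat := (P n.+1)%:Q / (Q n.+1)%:Q.

Lemma ratr_cf_conv n : ratr (cf_conv n) = p n.+1 / q n.+1 :> R.
Proof. by rewrite /cf_conv fmorph_div /= !ratr_int. Qed.

Lemma denq_cf_conv n : denq (cf_conv n) = Q n.+1.
Proof.
have q0 : 0 < Q n.+1 by case: (cf_den_gt0 n).
rewrite /cf_conv coprimeq_den; last first.
  apply/coprimezP; have e := cf_det n.
  exists ((-1) ^+ n.+1 * Q n, - (-1) ^+ n.+1 * P n) => /=.
  transitivity ((-1) ^+ n.+1 * (P n.+1 * Q n - P n * Q n.+1)); first by ring.
  by rewrite e -expr2 sqrr_sign.
by rewrite gtr0_norm // gt_eqF.
Qed.

(** The terms [u * d1] and [v * d2] have the same sign, so they cannot cancel, and [u] has absolute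
    value at least 1. *)
Lemma opposite_signs_norm (u v d1 d2 : R) : d1 * d2 < 0 ->
  (0 < v /\ u <= -1) \/ (v < 0 /\ 1 <= u) -> `|d1| <= `|u * d1 + v * d2|.
Proof.
move=> opp uv.
wlog u1 : u v d1 d2 opp uv / 1 <= u => [wl|].
  case: (uv) => -[h1 h2]; last by apply: wl opp uv _.
  have -> : u * d1 + v * d2 = - (- u * d1 + - v * d2) by ring.
  by rewrite normrN; apply: wl => //; [right; lra|lra].
have v0 : v < 0 by case: uv; lra.
wlog d10 : d1 d2 opp / 0 <= d1 => [wl|].
  have [/wl|d1n] := leP 0 d1; first exact.
  have -> : u * d1 + v * d2 = - (u * - d1 + v * - d2) by ring.
  by rewrite -normrN [leRHS]normrN; apply: wl; [rewrite mulrNN|lra].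
have d20 : d2 <= 0.
  by rewrite leNgt; apply/negP => h; move: opp; rewrite ltNge mulr_ge0 // ltW.
rewrite ger0_norm // ler_normr; apply/orP; left.
have h1 : 0 <= (u - 1) * d1 by rewrite mulr_ge0; lra.
have h2 : 0 <= v * d2 by rewrite mulr_le0; lra.
lra.
Qed.

Lemma legendre_bound (q1 d A D1 S : R) : 1 <= q1 -> q1 <= d -> A < 1 / (2 * d) ->
  D1 <= A -> 0 <= A -> S <= q1 * A + d * D1 -> S < 1.
Proof.
move=> q1_ge1 qd Ad DA A0 h.
have d0 : 0 < 2 * d by lra.
rewrite ltr_pdivlMr // in Ad.
have h1 : q1 * A <= d * A by rewrite ler_wpM2r.
have h2 : d * D1 <= d * A by rewrite ler_wpM2l //; lra.
lra.
Qed.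

(** Legendre's theorem: expressed through two consecutive convergents, a non-convergent would
    satisfy [1 <= |s * q - p * d| < 1]. *)
Lemma cf_legendre (r : rat) (k : R) : 2 <= k ->
  `|x - ratr r| < 1 / (k * (denq r)%:~R ^+ 2) -> exists n, r = cf_conv n.
Proof.
move=> k2; set d := denq r; set s := numq r => xr.
have d0 : 0 < d by exact: denq_gt0.
have er : ratr r = s%:~R / d%:~R :> R by rewrite /ratr.
have [n /andP[Qd dQ]] := cf_den_between (d0 : 1 <= d).
exists n.
pose e := (-1) ^+ n.+2 : int.
have ee : e * e = 1 by rewrite -expr2 sqrr_sign.
have det : P n.+2 * Q n.+1 - P n.+1 * Q n.+2 = e := cf_det n.+1.
(* The coordinates of [(s, d)] in the basis formed by two consecutive convergents; they are integers
   since the determinant is a sign. *)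
pose v := e * (s * Q n.+1 - P n.+1 * d); pose u := e * (P n.+2 * d - s * Q n.+2).
have eu : s = u * P n.+1 + v * P n.+2.
  transitivity (s * e * (P n.+2 * Q n.+1 - P n.+1 * Q n.+2)); last by rewrite /u /v; ring.
  by rewrite det -mulrA ee mulr1.
have ev : d = u * Q n.+1 + v * Q n.+2.
  transitivity (d * e * (P n.+2 * Q n.+1 - P n.+1 * Q n.+2)); last by rewrite /u /v; ring.
  by rewrite det -mulrA ee mulr1.
have [_ Q1] := cf_den_gt0 n; have [_ Q2] := cf_den_gt0 n.+1.
case: (eqVneq v 0) => v0.
  rewrite v0 !mul0r !addr0 in eu ev; clearbody u.
  have u0 : u != 0 by apply/eqP => u0; rewrite u0 mul0r in ev; lia.
  rewrite -[LHS]divq_num_den -/s -/d eu ev /cf_conv !rmorphM /=.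
  by rewrite -mulf_div divff ?mul1r // intr_eq0.
exfalso.
have vE : v = e * (s * Q n.+1 - P n.+1 * d) by [].
clearbody u v.
(* Forced by [0 < d < Q n.+2] and [v != 0]. *)
have uv : (0 < v /\ u < 0) \/ (v < 0 /\ 0 < u) by nia.
have dx : `|d%:~R * x - s%:~R| < 1 / (2 * d%:~R).
  have dR : (0 : R) < d%:~R by rewrite ltr0z.
  have -> : d%:~R * x - s%:~R = d%:~R * (x - ratr r).
    by rewrite er; field; lra.
  rewrite normrM gtr0_norm //.
  have h : 1 / (k * d%:~R ^+ 2) <= 1 / (2 * d%:~R ^+ 2) :> R.
    rewrite !div1r lef_pV2 ?posrE ?mulr_gt0 ?exprn_gt0 //; last by lra.
    by rewrite ler_pM2r ?exprn_gt0.
  have -> : 1 / (2 * d%:~R) = d%:~R * (1 / (2 * d%:~R ^+ 2)) :> R by field; lra.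
  by rewrite ltr_pM2l // (lt_le_trans xr).
have sR : s%:~R = u%:~R * p n.+1 + v%:~R * p n.+2 by rewrite [in LHS]eu rmorphD !rmorphM.
have dR : d%:~R = u%:~R * q n.+1 + v%:~R * q n.+2 by rewrite [in LHS]ev rmorphD !rmorphM.
have De : d%:~R * x - s%:~R = u%:~R * D n.+1 + v%:~R * D n.+2.
  by rewrite sR dR /D; ring.
have D12 : `|D n.+1| <= `|d%:~R * x - s%:~R|.
  have h1 := defectE n; have h2 := defectE n.+1.
  have q1 := q_ge1 n; have q2 := q_ge1 n.+1; have l1 := lam_gt1 n; have l2 := lam_gt1 n.+1.
  have w1 : 0 < lam n * q n.+1 by rewrite mulr_gt0 // ?(lt_trans ltr01 l1) ?(lt_trans ltr01 l2) ?(lt_le_trans ltr01).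
  have w2 : 0 < lam n.+1 * q n.+2 by rewrite mulr_gt0 // ?(lt_trans ltr01 l1) ?(lt_trans ltr01 l2) ?(lt_le_trans ltr01).
  have opp : D n.+1 * D n.+2 < 0.
    rewrite -(pmulr_llt0 _ w1) -(pmulr_llt0 _ w2).
    have -> : D n.+1 * D n.+2 * (lam n * q n.+1) * (lam n.+1 * q n.+2) =
      (D n.+1 * (lam n * q n.+1)) * (D n.+2 * (lam n.+1 * q n.+2)) by ring.
    by rewrite h1 h2 exprS mulrCA -expr2 sqrr_sign; lra.
  rewrite De; apply: opposite_signs_norm => //.
  case: uv => -[v1 u1]; [left|right]; rewrite ?ltr0z ?ltrz0; split=> //.
    by rewrite (_ : -1 = (-1)%:~R) // ler_int; clear -u1; lia.
  by rewrite ler1z; clear -u1; lia.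
have s1 : 1 <= `|s%:~R * q n.+1 - p n.+1 * d%:~R|.
  rewrite /p /q -!rmorphM -rmorphB /= -intr_norm ler1z.
  have : s * Q n.+1 - P n.+1 * d != 0 by apply: contraNN v0 => /eqP e0; rewrite vE e0 mulr0.
  by rewrite -normr_gt0 -gtz0_ge1.
have d1 : (1 : R) <= d%:~R by rewrite ler1z; clear -d0; lia.
have qd : q n.+1 <= d%:~R by rewrite /q ler_int.
have q1 := q_ge1 n.
have : `|s%:~R * q n.+1 - p n.+1 * d%:~R| <= q n.+1 * `|d%:~R * x - s%:~R| + d%:~R * `|D n.+1|.
  rewrite -[X in X * `|d%:~R * _ - _|]ger0_norm ?q_ge0 // -[X in _ + X * _]gtr0_norm; last by lra.
  rewrite -!normrM -[X in _ <= X + _]normrN.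
  by apply: le_trans (ler_normD _ _); rewrite /D le_eqVlt; apply/orP; left; apply/eqP; congr `|_|; ring.
set A := `|d%:~R * x - s%:~R| in dx D12 *.
move=> /(legendre_bound q1 qd dx D12 (normr_ge0 _)).
by rewrite ltNge s1.
Qed.

Lemma cf_irrational : irrational x.
Proof.
move=> [r _ rx].
have d0 : (0 : R) < (denq r)%:~R by rewrite ltr0z denq_gt0.
have [|n rn] := @cf_legendre r 2 (lexx _).
  by rewrite -rx subrr normr0 divr_gt0 // mulr_gt0 ?exprn_gt0.
have := cf_approx n; rewrite -ratr_cf_conv -rn -rx subrr normr0 => /esym/eqP.
have := lam_gt1 n; have := q_ge1 n => h1 h2.
by rewrite gt_eqF // divr_gt0 // mulr_gt0 ?exprn_gt0 //; lra.
Qed.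

Lemma cf_approx_denq n :
  `|x - ratr (cf_conv n)| = 1 / (lam n * (denq (cf_conv n))%:~R ^+ 2).
Proof. by rewrite denq_cf_conv ratr_cf_conv cf_approx. Qed.

Lemma cf_conv_approx (k : R) n : 0 < k ->
  (`|x - ratr (cf_conv n)| < 1 / (k * (denq (cf_conv n))%:~R ^+ 2)) = (k < lam n).
Proof.
move=> k0; have l1 := lam_gt1 n.
have d0 : (0 : R) < (denq (cf_conv n))%:~R ^+ 2 by rewrite exprn_gt0 // ltr0z denq_gt0.
have l0 : 0 < lam n by apply: lt_trans l1.
rewrite cf_approx_denq !div1r ltf_pV2 ?posrE; [|exact: mulr_gt0|exact: mulr_gt0].
by rewrite ltr_pM2r.
Qed.

(** * The approximation constant as an upper limit over convergents *)

Lemma approx_constant_ge (k : R) : 0 < k ->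
  (forall m, exists2 n, (m <= n)%N & k < al n.+1 + cf_back R a n) ->
  (k%:E <= approx_constant x)%E.
Proof.
move=> k0 kl; apply: ereal_sup_ubound; exists k => //; split=> //.
move=> /finite_seqP[s As].
(* The index exceeds every denominator in the list, while the denominator of the [n]-th convergent
   is at least [n]. *)
have [n nM kn] := kl (\sum_(r <- s) `|denq r|).+1%N.
have : [set` s] (cf_conv n) by rewrite -As /= cf_conv_approx.
move=> /= ns; move: nM; rewrite (big_rem _ ns) /= denq_cf_conv.
by have := cf_den_ge n; lia.
Qed.

(** By Legendre's theorem, which needs [2 <= k], solutions for a constant above [k] are convergents
    of index below [m]. *)
Lemma approx_constant_le (k : R) m : 2 <= k ->
  (forall n, (m <= n)%N -> al n.+1 + cf_back R a n <= k) ->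
  (approx_constant x <= k%:E)%E.
Proof.
move=> k2 kl; apply: ge_ereal_sup => _ [l [l0 inf_l] <-]; rewrite lee_fin leNgt.
apply/negP => kl'; apply: inf_l.
apply: (@sub_finite_set _ _ [set cf_conv n | n in `I_m]); last first.
  exact: finite_image.
move=> r rl; have [|n rn] := cf_legendre _ rl; first lra.
exists n => //=; rewrite ltnNge; apply/negP => /kl.
by move: rl; rewrite /= rn cf_conv_approx // /lam; lra.
Qed.

End ContinuedFractions.

Lemma cf_expansion_exists (R : realType) (x : R) : irrational x ->
  exists a, exists2 al, cf_expansion a al & al 0%N = x.
Proof.
move=> ix; pose f (y : R) := (y - (Num.floor y)%:~R)^-1.
pose al n := iter n f x; exists (fun n => Num.floor (al n)), al => // n.
have frac y : irrational y -> 0 < y - (Num.floor y)%:~R < 1 /\ irrational (f y).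
  move=> iy; have /andP[h1 h2] := floor_itv y; rewrite rmorphD /= in h2.
  have yf : y != (Num.floor y)%:~R.
    apply/eqP => e; apply: iy; exists (Num.floor y)%:Q => //.
    by rewrite ratr_int.
  split; first by move: yf; rewrite eq_sym neq_lt; lra.
  move=> [r _ rf]; apply: iy; exists ((Num.floor y)%:Q + r^-1) => //.
  by rewrite rmorphD /= fmorphV /= ratr_int rf /f invrK; ring.
have ial : irrational (al n) by elim: n => // n /frac[].
have [/andP[h1 h2] _] := frac _ ial; split; first by rewrite /= /f invrK; ring.
by rewrite /= /f invf_gt1.
Qed.

(** Both numbers lie within [1 / n] of the [n]-th convergent, which depends on the digits only. *)
Lemma cf_expansion_inj (R : realType) a (al al' : nat -> R) :
  cf_expansion a al -> cf_expansion a al' -> al 0%N = al' 0%N.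
Proof.
move=> h h'; apply/eqP; rewrite -subr_eq0 -normr_eq0; apply/negPn/negP => e.
have e0 : 0 < `|al 0%N - al' 0%N| by rewrite lt_neqAle eq_sym e normr_ge0.
set d := `|_| in e0.
have bound n (al1 : nat -> R) : cf_expansion a al1 ->
    `|al1 0%N - ratr (cf_conv a n)| * n%:R <= 1.
  move=> h1; have := cf_approx h1 n; rewrite -ratr_cf_conv => ->.
  have q1 : 1 <= (cf_den a n.+1)%:~R :> R by rewrite ler1z; case: (cf_den_gt0 h1 n); lia.
  have qn : n%:R <= (cf_den a n.+1)%:~R :> R by rewrite -[n%:R]/(n%:Z%:~R) ler_int (cf_den_ge h1).
  have l1 : 1 < al1 n.+1 + cf_back R a n by have := cf_gt1 h1 n; have := cf_back_bounds h1 n; lra.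
  rewrite mulrAC mul1r ler_pdivrMr ?mul1r ?mulr_gt0 ?exprn_gt0 //; try lra.
  rewrite -[leLHS]mul1r ler_pM //; [lra|].
  by rewrite expr2 -[leLHS]mul1r ler_pM.
have [n nd] : exists n : nat, 2 < d * n%:R.
  exists (Num.truncn (2 / d)).+1; rewrite mulrC -ltr_pdivrMr //.
  exact: truncnS_gt.
have := bound n _ h; have := bound n _ h'; set c := ratr _ => b1 b2.
have : d <= `|al 0%N - c| + `|al' 0%N - c|.
  by rewrite /d -[`|al' 0%N - c|]normrN; apply: le_trans (ler_normD _ _); rewrite le_eqVlt; apply/orP; left; apply/eqP; congr `|_|; ring.
move=> h2; have : d * n%:R <= (`|al 0%N - c| + `|al' 0%N - c|) * n%:R by rewrite ler_wpM2r.
by rewrite mulrDl; lra.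
Qed.

(** * The spectrum below 3 *)

Lemma inv_sub_inv (F : fieldType) (x y z : F) : x + y != 0 -> x + z != 0 ->
  (x + y)^-1 - (x + z)^-1 = - ((x + y)^-1 * (x + z)^-1) * (y - z).
Proof. by move=> h1 h2; field; rewrite h1 h2. Qed.

Lemma inv_bounds (F : realFieldType) (x lo hi : F) :
  0 < lo -> lo <= x <= hi -> hi^-1 <= x^-1 <= lo^-1.
Proof.
move=> lo0 /andP[h1 h2].
have x0 : 0 < x by apply: lt_le_trans h1.
by rewrite !lef_pV2 ?posrE ?h1 ?h2 // (lt_le_trans x0).
Qed.

Lemma inv_gap (F : realFieldType) (u v e : F) : 0 < e -> 0 <= u <= 1 ->
  0 <= v <= 1 -> e <= (2 + u)^-1 - (2 + v)^-1 -> e <= v - u.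
Proof.
move=> e0 hu hv; rewrite inv_sub_inv; [|lra|lra].
have h1 := @inv_bounds F (2 + v) 1 3 ltr01 ltac:(lra).
have h2 := @inv_bounds F (2 + u) 1 3 ltr01 ltac:(lra).
rewrite invr1 in h1 h2; set c := _ * _^-1.
have c0 : 0 < c by rewrite mulr_gt0; lra.
have c1 : c <= 1 by rewrite mulr_ile1; lra.
rewrite mulNr -mulrN opprB => h.
have vu : 0 < v - u by rewrite -(pmulr_rgt0 _ c0); lra.
by apply: (le_trans h); rewrite ler_piMl // ltW.
Qed.

Lemma inv_one_one (F : realFieldType) (w : F) : 0 <= w ->
  (1 + (1 + w)^-1)^-1 = 1 - (2 + w)^-1.
Proof.
move=> w0; have -> : 1 + (1 + w)^-1 = (2 + w) / (1 + w) by field; lra.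
by rewrite invf_div; field; lra.
Qed.

Ltac lia_no_reals := repeat match goal with
  | H : context [@GRing.inv _ _] |- _ => clear H
  | H : context [@cf_back _ _ _] |- _ => clear H
  | H : context [@intmul _ _ _] |- _ => clear H
  end; lia_no_bits.

Section SmallLagrangeValue.
Variables (R : realType) (a : nat -> int) (al : nat -> R).
Hypothesis cf : cf_expansion a al.
Variables (kappa : R) (m : nat).
Hypothesis kappa3 : kappa < 3.
Hypothesis lam_le :
  forall n, (m <= n)%N -> al n.+1 + cf_back R a n <= kappa.

Local Notation beta := (cf_back R a).
Local Notation sigma n := (al n)^-1.

Let sigma_bounds n : 0 < sigma n.+1 < 1.
Proof.
have h := cf_gt1 cf n.
by rewrite invr_gt0 invf_lt1; lra.
Qed.

Let sigmaE n : sigma n = ((a n)%:~R + sigma n.+1)^-1.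
Proof. by rewrite {1}(cf n).1. Qed.

Let betaE n : beta n.+1 = ((a n.+1)%:~R + beta n)^-1.
Proof. by []. Qed.

Let lamE n : (m <= n)%N -> (a n.+1)%:~R + sigma n.+2 + beta n <= kappa.
Proof. by move=> /lam_le; rewrite (cf n.+1).1. Qed.

Let z i := a i == 2.

Let digitE i : (m < i)%N -> a i = 1 + (z i : nat)%:Z.
Proof.
case: i => // i; rewrite ltnS => mi; rewrite /z.
have h1 := cf_digitS_ge1 cf i; have h2 := lamE mi.
have := sigma_bounds i.+1; have := cf_back_bounds cf i => hb hs.
have : (a i.+1)%:~R < 3 :> R by move: kappa3; lra.
by rewrite -[3]/((3%:Z)%:~R) ltr_int; case: eqP => /=; lia.
Qed.

Let digitR i : (m < i)%N -> (a i)%:~R = (if z i then 2 else 1) :> R.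
Proof. by move=> /digitE->; case: (z i). Qed.

Let digit_bounds i : (m < i)%N -> 1 <= ((a i)%:~R : R) <= 2.
Proof. by move=> /digitR->; case: (z i); lra. Qed.

Let beta_bounds i : (m < i)%N -> 1/3 <= beta i <= 1.
Proof.
case: i => // i mi; rewrite betaE.
have h := digit_bounds mi; have hb := cf_back_bounds cf i.
have := @inv_bounds R ((a i.+1)%:~R + beta i) 1 3 ltr01 ltac:(lra).
by rewrite invr1; lra.
Qed.

Let sigma_ge i : (m < i)%N -> 1/3 <= sigma i <= 1.
Proof.
move=> mi; rewrite sigmaE.
have h := digit_bounds mi; have hs := sigma_bounds i.
have := @inv_bounds R ((a i)%:~R + sigma i.+1) 1 3 ltr01 ltac:(lra).
by rewrite invr1; lra.
Qed.

(** Each common digit multiplies the difference by a negative factor of size at most [9/16]. Only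
    the weaker decay [c <= 2 / (d + 2)] is recorded, which suffices to bound [d]. *)
Let mirror p q d : (m + d < p)%N -> (m < q)%N ->
  (forall j, (j < d)%N -> z (p - j)%N = z (q + j)%N) ->
  exists2 c : R, 0 < c /\ c * (d%:R + 2) <= 2 &
    beta p - sigma q = (-1) ^+ d * c * (beta (p - d)%N - sigma (q + d)%N).
Proof.
elim: d => [|d IH] mp mq zpq.
  by exists 1; [lra|rewrite subn0 addn0 expr0; ring].
have [||j jd|c [c0 c2] e] := IH; [lia_no_reals|by []|apply: zpq; lia_no_reals|].
have zd := zpq d (leqnn _).
have pd : (p - d = (p - d.+1).+1)%N by lia_no_reals.
rewrite {}pd in zd e; rewrite addnS; set p' := (p - d.+1)%N in zd e *.
set q' := (q + d)%N in zd e *.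
have mp' : (m < p')%N by rewrite /p'; lia_no_reals.
have mq' : (m < q')%N by rewrite /q'; lia_no_reals.
have ea : (a q')%:~R = (a p'.+1)%:~R :> R by rewrite !digitR ?zd //; lia_no_reals.
have hb := beta_bounds mp'; have hs := sigma_ge (ltnW mq' : (m < q'.+1)%N).
have ha := digit_bounds (ltnW mp' : (m < p'.+1)%N).
set A := (a p'.+1)%:~R in ha ea.
have eb : beta p'.+1 = (A + beta p')^-1 by exact: betaE.
have es : sigma q' = (A + sigma q'.+1)^-1 by rewrite sigmaE ea.
clearbody A.
have nb : A + beta p' != 0 by lra.
have ns : A + sigma q'.+1 != 0 by lra.
have hb' := @inv_bounds R (A + beta p') (4/3) 3 ltac:(lra) ltac:(lra).
have hs' := @inv_bounds R (A + sigma q'.+1) (4/3) 3 ltac:(lra) ltac:(lra).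
exists (c * (beta p'.+1 * sigma q')).
  rewrite eb es; set B := (A + beta p')^-1 in hb' *; set S := (A + sigma q'.+1)^-1 in hs' *.
  have {}hb' : 0 < B <= 3/4 by lra.
  have {}hs' : 0 < S <= 3/4 by lra.
  have BS : 0 < B * S by rewrite mulr_gt0; lra.
  split; first by rewrite mulr_gt0.
  have BS2 : B * S <= 9/16.
    by rewrite (_ : 9/16 = 3/4 * (3/4)) ?ler_pM //; lra.
  have d0 : 0 <= d%:R :> R by [].
  have c1 : c * (B * S) * (d.+1%:R + 2) <= c * (9/16) * (d.+1%:R + 2).
    by rewrite ler_wpM2r ?addr_ge0 // ler_wpM2l // ltW.
  apply: (le_trans c1); rewrite -natr1.
  have : 0 <= c * d%:R by rewrite mulr_ge0 // ltW.
  lra.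
by rewrite e exprS eb es inv_sub_inv //; ring.
Qed.

(** In [2 1 2] the value at the first 2 is at least [2 + 2/3 + 1/3], and in [1 2 1] the value at the
    2 is at least [2 + 1/2 + 1/2]; both reach 3. *)
Let no_isolated_digit i : (m + 3 <= i)%N -> z i.-1 != z i -> z i.+1 = z i.
Proof.
case: i => [|[|i]]; [lia_no_reals|lia_no_reals|] => mi /= zi.
have [//|zi1] := eqVneq (z i.+3) (z i.+2); exfalso.
have {zi1} e : z i.+3 = z i.+1 by move: zi zi1; case: (z i.+1); case: (z i.+2); case: (z i.+3).
have d1 := @digitR i.+1 ltac:(lia_no_reals); have d2 := @digitR i.+2 ltac:(lia_no_reals).
have d3 := @digitR i.+3 ltac:(lia_no_reals); rewrite e in d3.
have b0 := cf_back_bounds cf i; have s4 := sigma_bounds i.+3.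
have lam1 := @lamE i ltac:(lia_no_reals); have lam2 := @lamE i.+1 ltac:(lia_no_reals).
have s3 := sigmaE i.+3; have s2 := sigmaE i.+2; have b1 := betaE i.
rewrite d1 in b1 lam1; rewrite d3 in s3; rewrite d2 in s2 lam2.
move: zi d1 d2 d3 s3 s2 b1 lam1 lam2 {e}; case: (z i.+1); case: (z i.+2) => //= _ _ _ _ s3 s2 b1 lam1 lam2.
- have h1 := @inv_bounds R (2 + sigma i.+4) 2 3 ltac:(lra) ltac:(lra).
  have h2 := @inv_bounds R (1 + sigma i.+3) 1 (3/2) ltac:(lra) ltac:(lra).
  have h3 := @beta_bounds i ltac:(lia_no_reals); move: kappa3; lra.
- have h1 := @inv_bounds R (1 + sigma i.+4) 1 2 ltac:(lra) ltac:(lra).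
  have h2 := @inv_bounds R (1 + beta i) 1 2 ltac:(lra) ltac:(lra).
  move: kappa3; lra.
Qed.

(* [sigma i.+3] and [beta (i - 2)] are the outward readings past the transition;
   the digit 2 at position i or i.+1 has value 3 + 1/(2 + r) - 1/(2 + s). *)
Let gap i : (m + 5 <= i)%N -> z i != z i.+1 ->
  3 - kappa <= (-1) ^+ z i * (sigma i.+3 - beta (i - 2)%N).
Proof.
move=> mi zi.
have z1 : z i.+2 = z i.+1 by apply: no_isolated_digit => //; lia_no_reals.
have z2 : z i.-1 = z i.
  have [//|h] := eqVneq (z i.-1) (z i); have := @no_isolated_digit i ltac:(lia_no_reals) h.
  by move=> e; rewrite e eqxx in zi.
have -> : (i - 2 = i.-2)%N by lia_no_reals.
case: i mi zi z1 z2 => [|[|i]]; [lia_no_reals|lia_no_reals|] => mi zi z1 z2.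
rewrite [i.+2.-2]/=; rewrite [i.+2.-1]/= in z2.
have d1 := @digitR i.+1 ltac:(lia_no_reals); have d2 := @digitR i.+2 ltac:(lia_no_reals).
have d3 := @digitR i.+3 ltac:(lia_no_reals); have d4 := @digitR i.+4 ltac:(lia_no_reals).
rewrite z2 in d1; rewrite z1 in d4.
have lam1 := @lamE i.+1 ltac:(lia_no_reals); have lam2 := @lamE i.+2 ltac:(lia_no_reals).
have b1 := betaE i; have b2 := betaE i.+1; have s4 := sigmaE i.+4; have s3 := sigmaE i.+3.
rewrite d1 in b1; rewrite d2 in lam1 b2; rewrite d3 in s3 lam2; rewrite d4 in s4.
have hb := cf_back_bounds cf i; have hs := sigma_bounds i.+4.
set r := beta i in b1 hb *; set s := sigma i.+4.+1 in hs s4 *.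
have e0 : 0 < 3 - kappa by rewrite subr_gt0.
move: zi b1 b2 s3 s4 lam1 lam2 {d1 d2 d3 d4 z1 z2}.
case: (z i.+2); case: (z i.+3) => //= _ b1 b2 s3 s4 lam1 lam2.
- rewrite expr1 mulN1r opprB; apply: inv_gap => //; [lra|].
  move: lam1; rewrite s3 s4 b1 inv_one_one; last by case/andP: hs => /ltW.
  lra.
- rewrite expr0 mul1r; apply: inv_gap => //; [lra|].
  move: lam2; rewrite s4 b2 b1 inv_one_one; last by case/andP: hb.
  lra.
Qed.

Let digits_markov : exists N n0, digit_markov N n0 z.
Proof.
(* If the outward readings agreed for [N] digits, [mirror] would make their difference smaller than
   the gap [3 - kappa]. *)
have [N hN] : exists N : nat, 2 < (3 - kappa) * N%:R.
  exists (Num.truncn (2 / (3 - kappa))).+1; rewrite mulrC -ltr_pdivrMr ?subr_gt0 //.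
  exact: truncnS_gt.
exists N, (m + N + 6)%N => i mi zi.
have z1 : z i.+2 = z i.+1 by apply: no_isolated_digit => //; lia_no_reals.
have z2 : z i.-1 = z i.
  have [//|h] := eqVneq (z i.-1) (z i); have := @no_isolated_digit i ltac:(lia_no_reals) h.
  by move=> e; rewrite e eqxx in zi.
split=> //.
have g := @gap i ltac:(lia_no_reals) zi.
pose P j := (j < N)%N && (z (i - j.+2) != z (i + j.+3)%N).
have [exP|nP] := pselect (exists j, P j); last first.
  have [||j jN|c [c0 c2] e] := @mirror (i - 2) i.+3 N; [lia_no_reals|lia_no_reals| |].
    have -> : (i.+3 + j = i + j.+3)%N by rewrite addSnnS addSnnS addSnnS.
    have -> : (i - 2 - j = i - j.+2)%N by rewrite -subnDA.
    have [//|h] := eqVneq (z (i - j.+2)) (z (i + j.+3)%N).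
    by exfalso; apply: nP; exists j; rewrite /P jN.
  have : 3 - kappa <= c.
    apply: (le_trans g); rewrite -opprB mulrN e -mulNr !mulrA.
    apply: (le_trans (ler_norm _)); rewrite normrM normrM !normrM normrN !normrX normrN1 !expr1n !mul1r.
    rewrite gtr0_norm // ler_piMr //; first exact: ltW.
    have hb := @beta_bounds (i - 2 - N) ltac:(lia_no_reals).
    have hs := @sigma_ge (i.+3 + N) ltac:(lia_no_reals).
    by rewrite ler_norml; lra.
  move=> kc; have : (3 - kappa) * N%:R <= c * N%:R by rewrite ler_wpM2r.
  lra.
have [d /andP[dN zd] dmin] := ex_minnP exP.
have agree j : (j < d)%N -> z (i - j.+2) = z (i + j.+3).
  move=> jd; have [//|h] := eqVneq (z (i - j.+2)) (z (i + j.+3)%N); have := dmin j.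
  by rewrite /P h andbT => /(_ ltac:(lia_no_reals)); lia_no_reals.
exists d => //; split=> //.
have [||j jd|c [c0 c2] e] := @mirror (i - 2) i.+3 d; [lia_no_reals|lia_no_reals| |].
  have -> : (i.+3 + j = i + j.+3)%N by rewrite !addSnnS.
  have -> : (i - 2 - j = i - j.+2)%N by rewrite -subnDA.
  exact: agree.
have ed : (i.+3 + d = i + d.+3)%N by rewrite !addSnnS.
have ed' : (i - 2 - d = i - d.+2)%N by rewrite -subnDA.
rewrite ed ed' in e.
set B := beta (i - d.+2)%N in e; set S := sigma (i + d.+3)%N in e.
(* The gap fixes the sign of [B - S]. As the larger leading digit gives the smaller value, this
   decides which side carries the 2, depending on the parity of [d]. *)
have sgn : 0 < (-1) ^+ z i * - ((-1) ^+ d * (B - S)).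
  move: g; rewrite -[_^-1 - _]opprB e => g.
  rewrite -(pmulr_rgt0 _ c0); apply: lt_le_trans (_ : 0 < 3 - kappa) _; first by rewrite subr_gt0.
  by apply: (le_trans g); rewrite mulrCA [c * - _]mulrN [c * (_ * _)]mulrA (mulrC c).
have hB : B = ((if z (i - d.+2) then 2 else 1) + beta (i - d.+3))^-1.
  by rewrite /B (_ : i - d.+2 = (i - d.+3).+1)%N ?betaE ?digitR //; lia_no_reals.
have hS : S = ((if z (i + d.+3)%N then 2 else 1) + sigma (i + d.+3).+1)^-1.
  by rewrite /S sigmaE digitR //; lia_no_reals.
have hb := cf_back_bounds cf (i - d.+3); have hs := sigma_bounds (i + d.+3).
have hb1 := @inv_bounds R (2 + beta (i - d.+3)) 2 3 ltac:(lra) ltac:(lra).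
have hs1 := @inv_bounds R (2 + sigma (i + d.+3).+1) 2 3 ltac:(lra) ltac:(lra).
have hb0 := @inv_bounds R (1 + beta (i - d.+3)) 1 2 ltac:(lra) ltac:(lra).
have hs0 := @inv_bounds R (1 + sigma (i + d.+3).+1) 1 2 ltac:(lra) ltac:(lra).
clear g e.
move: sgn; rewrite -[(-1) ^+ d]signr_odd; move: zi zd hB hS.
case: (z i); case: (z i.+1) => //= _; case: (z (i - d.+2)); case: (z (i + d.+3)) => //= _ hB hS;
  case: (odd d) => //= sgn; exfalso; move: sgn;
  rewrite ?expr0 ?expr1 ?mulN1r ?mul1r hB hS; lra.
Qed.

Lemma cf_digits_eventually_periodic : eventually_periodic a.
Proof.
have [N [n0 /digit_markov_eventually_periodic[n [p [p0 zp]]]]] := digits_markov.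
exists (m + n).+1, p; split=> // i ni.
by rewrite !digitE ?zp //; lia_no_reals.
Qed.

End SmallLagrangeValue.

(** * Countability of the spectrum below 3 *)

Lemma lagrange_gt0 (R : realType) (x l : R) : approx_constant x = l%:E -> 0 < l.
Proof.
rewrite /approx_constant; set A := [set k%:E | k in _] => Al.
have [A0|/set0P[y [k [k0 h] ky]]] := eqVneq A set0; first by rewrite A0 ereal_sup0 in Al.
by rewrite (lt_le_trans k0) // -lee_fin -Al; apply: ereal_sup_ubound; exists k => //; split.
Qed.

Lemma lagrange_lt3_eventually_periodic (R : realType) (x l : R) :
  irrational x -> approx_constant x = l%:E -> l < 3 ->
  exists2 a, eventually_periodic a & exists2 al, cf_expansion a al & al 0%N = x.
Proof.
move=> ix xl l3; have [a [al cf al0]] := cf_expansion_exists ix.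
exists a; last by exists al.
have l0 := lagrange_gt0 xl.
(* Strictly between [l] and 3: exceeding [kappa] infinitely often would make the approximation
   constant larger than [l]. *)
pose kappa := (l + 3) / 2.
have [[m hm]|nm] := pselect (exists m, forall n, (m <= n)%N -> al n.+1 + cf_back R a n <= kappa).
  by apply: cf_digits_eventually_periodic hm => //; rewrite /kappa; lra.
have kl : (kappa%:E <= approx_constant (al 0%N))%E.
  apply: (approx_constant_ge cf); first by rewrite /kappa; lra.
  move=> m; apply: contrapT => h; apply: nm; exists m => n mn.
  by rewrite leNgt; apply/negP => hn; apply: h; exists n.
by move: kl; rewrite al0 xl lee_fin /kappa; lra.
Qed.

(** An eventually periodic sequence is coded in a countable type by its preperiod length, its period
    and finitely many digits. *)
Definition periodic_decode (c : nat * nat * seq int) (i : nat) : int :=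
  let: (n, p, s) := c in
  nth 0 s (if (i < n + p)%N then i else (n + (i - n) %% p)%N).

Lemma periodic_decode_onto (a : nat -> int) :
  eventually_periodic a -> exists c, a = periodic_decode c.
Proof.
move=> [n [p [p0 ap]]]; exists (n, p, mkseq a (n + p)); apply/funext => i /=.
have apk k j : (n <= j)%N -> a (j + k * p)%N = a j.
  move=> nj; elim: k => [|k IH]; first by rewrite mul0n addn0.
  by rewrite mulSnr addnA ap ?IH // (leq_trans nj) ?leq_addr.
case: ltnP => ip; first by rewrite nth_mkseq.
rewrite nth_mkseq ?ltn_add2l ?ltn_mod // -[RHS](apk ((i - n) %/ p)%N) ?leq_addr //.
by rewrite -addnA [(_ %% _ + _)%N]addnC -divn_eq subnKC // (leq_trans _ ip) ?leq_addr.
Qed.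

Lemma countable_lagrange_lt3 (R : realType) :
  countable (@lagrange_spectrum R `&` [set x | x < 3]).
Proof.
pose X c := [set x : R | exists2 al, cf_expansion (periodic_decode c) al & al 0%N = x].
(* The real chosen by [xget] does not matter when one exists, by [cf_expansion_inj]; codes of no
   expansion give the harmless default 0. *)
pose F c := fine (approx_constant (xget 0 (X c))).
apply: (@sub_countable _ _ _ [set: nat * nat * seq int]); last exact: countableP.
apply: card_le_trans (card_image_le F setT); apply: subset_card_le => l [[x ix xl] l3].
have [a /periodic_decode_onto[c ->] [al cf al0]] := lagrange_lt3_eventually_periodic ix xl l3.
exists c => //; rewrite /F; case: xgetP => [y -> [al' cf' al'0]|/(_ x)]; last by case; exists al.
by rewrite -al'0 (cf_expansion_inj cf' cf) al0 xl.
Qed.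

(** * Hausdorff dimension *)

Section HausdorffDimensionBounds.
Variable R : realType.
Implicit Types (A U : set R) (s : R).

Lemma diam_ge0 U : (0 <= diam U)%E.
Proof. by rewrite /diam le_max lexx. Qed.

Lemma diam_le U (r : R) : 0 <= r -> (forall x y, U x -> U y -> `|x - y| <= r) ->
  (diam U <= r%:E)%E.
Proof.
move=> r0 h; rewrite /diam ge_max lee_fin r0 /=.
by apply: ge_ereal_sup => _ [x Ux [y Uy <-]]; rewrite lee_fin h.
Qed.

Lemma le_diam U x y : U x -> U y -> (`|x - y|%:E <= diam U)%E.
Proof.
by move=> Ux Uy; rewrite /diam le_max ereal_sup_ubound ?orbT //; exists x => //; exists y.
Qed.

Lemma hausdorff_content_ge0 delta s A : (0 <= hausdorff_content delta s A)%E.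
Proof.
apply/ereal_infP => _ [U _ <-]; apply: nneseries_ge0 => n _ _; exact: poweR_ge0.
Qed.

Lemma hausdorff_measure_eq0 s A :
  (forall delta e : R, 0 < delta -> 0 < e -> exists2 U : (set R)^nat,
     A `<=` \bigcup_n U n /\ forall n, (diam (U n) <= delta%:E)%E &
     (\sum_(0 <= n <oo) diam (U n) `^ s <= e%:E)%E) ->
  hausdorff_measure s A = 0%E.
Proof.
move=> h; apply/eqP; rewrite eq_le; apply/andP; split.
  apply: ge_ereal_sup => _ [delta d0 <-]; apply/lee_addgt0Pr => e e0.
  rewrite add0e; have [U hU Ue] := h _ _ d0 e0.
  by apply: le_trans Ue; apply: ereal_inf_lbound; exists U.
apply: le_trans (hausdorff_content_ge0 1 s A) _.
by apply: ereal_sup_ubound; exists 1 => //=; exact: ltr01.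
Qed.

Lemma hausdorff_dim_ge0 A : (0 <= hausdorff_dim A)%E.
Proof. by apply/ereal_infP => _ [s [s0 _] <-]; rewrite lee_fin ltW. Qed.

Lemma hausdorff_dim_le A s : 0 <= s ->
  (forall s', s < s' -> hausdorff_measure s' A = 0%E) -> (hausdorff_dim A <= s%:E)%E.
Proof.
move=> s0 h; apply/lee_addgt0Pr => e e0.
by apply: ereal_inf_lbound; exists (s + e) => //; split; [lra|apply: h; lra].
Qed.

Lemma hausdorff_dim_countable A : countable A -> hausdorff_dim A = 0%E.
Proof.
move=> cA; apply/eqP; rewrite eq_le hausdorff_dim_ge0 andbT.
apply: hausdorff_dim_le => // s s0; apply: hausdorff_measure_eq0 => delta e d0 e0.
have [U AU dU] : exists2 U : (set R)^nat, A `<=` \bigcup_n U n & forall n, diam (U n) = 0%E.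
  have diam1 (x : R) : diam [set x] = 0%E.
    apply/eqP; rewrite eq_le diam_ge0 andbT; apply: diam_le => // y z /= -> ->.
    by rewrite subrr normr0.
  have [A0|[f]] := pfcard_geP cA; first by exists (fun=> [set 0]) => //; rewrite A0.
  exists (fun n => [set f n]) => // x Ax.
  by have [n _ nx] := (@surj _ _ _ _ f) x Ax; exists n.
exists U; first by split=> // n; rewrite dU lee_fin ltW.
rewrite eseries0 ?lee_fin ?ltW // => n _ _.
by rewrite dU poweR0r // gt_eqF.
Qed.

Lemma hausdorff_dim_bounded A (T : R) : A `<=` `[0, T] -> (hausdorff_dim A <= 1%:E)%E.
Proof.
wlog T0 : T / 0 < T => [wl AT|AT].
  apply: (wl (Num.max T 1)); first by rewrite lt_max ltr01 orbT.
  move=> x /AT /=; rewrite !in_itv /= => /andP[-> xT] /=.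
  by rewrite le_max xT.
apply: hausdorff_dim_le => // s s1; apply: hausdorff_measure_eq0 => delta e d0 e0.
(* With [N] pieces of length [c = T / N], the cost is [N * c ^ s = T * c ^ (s - 1)], at most [e]
   once [c <= (e / T) ^ (1 / (s - 1))]. *)
pose d := Num.min delta ((e / T) `^ (s - 1)^-1).
have dd0 : 0 < d by rewrite /d lt_min d0 powR_gt0 // divr_gt0.
have [N Npos TN] : exists2 N : nat, (0 < N)%N & T / N%:R <= d.
  exists (Num.truncn (T / d)).+1 => //.
  by rewrite ler_pdivrMr // mulrC -ler_pdivrMr // ltW // truncnS_gt.
have N0 : 0 < N%:R :> R by rewrite ltr0n.
pose c := T / N%:R.
have c0 : 0 < c by rewrite divr_gt0.
pose U n : set R := if (n < N)%N then `[c * n%:R, c * n.+1%:R]%classic else set0.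
have dU n : (diam (U n) <= (if (n < N)%N then c else 0)%:E)%E.
  apply: diam_le; first by case: ifP => // _; exact: ltW.
  rewrite /U; case: ifP => // _ x y /=; rewrite !in_itv /= -natr1 mulrDr mulr1.
  by move=> /andP[x1 x2] /andP[y1 y2]; rewrite ler_norml; lra.
exists U; first split.
- move=> x /AT /=; rewrite in_itv /= => /andP[x0 xT].
  have xc : 0 <= x / c by rewrite divr_ge0 // ltW.
  pose k := Num.truncn (x / c).
  have /andP[k1 k2] : k%:R <= x / c < k.+1%:R by rewrite truncn_itv.
  rewrite ler_pdivlMr // in k1; rewrite ltr_pdivrMr // in k2.
  have [kN|Nk] := ltnP k N.
    by exists k => //; rewrite /U kN /= in_itv /= mulrC k1 mulrC ltW.
  (* Only the endpoint [x = T] gives [k >= N]; it belongs to the last closed piece. *)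
  exists N.-1 => //; rewrite /U ltn_predL Npos /= in_itv /= /c.
  have : N%:R * c <= x by apply: le_trans k1; rewrite ler_pM2r // ler_nat.
  rewrite /c mulrC divfK ?gt_eqF // => Tx.
  have -> : x = T by apply/eqP; rewrite eq_le xT.
  rewrite prednK // divfK ?gt_eqF // lexx andbT.
  by rewrite -mulrA ger_pMr // mulrC ler_pdivrMr // mul1r ler_nat leq_pred.
- move=> n; apply: le_trans (dU n) _; rewrite lee_fin; case: ifP => _; last exact: ltW.
  by apply: le_trans TN _; rewrite /d ge_min lexx.
have cs : N%:R * c `^ s <= e.
  rewrite -(@mulr_powRB1 R c s) ?(ltW c0) //; last lra.
  rewrite mulrA [N%:R * c]mulrC /c divfK ?gt_eqF // -/c mulrC -ler_pdivlMr //.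
  have h : c `^ (s - 1) <= ((e / T) `^ (s - 1)^-1) `^ (s - 1).
    apply: ge0_ler_powR; rewrite ?nnegrE ?powR_ge0 ?(ltW c0) //; first lra.
    by apply: le_trans TN _; rewrite /d ge_min lexx orbT.
  apply: le_trans h _; rewrite -powRrM mulVf; last by rewrite subr_eq0 gt_eqF.
  by rewrite powRr1 // divr_ge0 // ltW.
apply: lime_le; first by apply: is_cvg_nneseries => n _ _; exact: poweR_ge0.
apply: nearW => M.
pose g n : R := if (n < N)%N then c `^ s else 0.
apply: (@le_trans _ _ (\sum_(0 <= n < M) (g n)%:E)%E).
  apply: lee_sum => n _; rewrite /g; case: ifP (dU n) => nN h.
    rewrite -poweR_EFin; apply: gt0_ler_poweR => //; first lra.
      by rewrite in_itv /= diam_ge0 leey.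
    by rewrite in_itv /= lee_fin ltW // leey.
  have -> : diam (U n) = 0%E by apply/eqP; rewrite eq_le h diam_ge0.
  by rewrite poweR0r // gt_eqF // (lt_trans ltr01).
rewrite sumEFin lee_fin; apply: le_trans cs.
have -> : \sum_(0 <= n < M) g n = (minn M N)%:R * c `^ s.
  elim: M => [|M IH]; first by rewrite big_nil min0n mul0r.
  rewrite big_nat_recr //= IH /g; case: ltnP => MN.
    by rewrite (minn_idPl MN) -natr1; ring.
  by rewrite addr0 (minn_idPr (leqW MN)).
by rewrite ler_wpM2r ?powR_ge0 // ler_nat geq_minr.
Qed.

(* Mass distribution principle for the image of Lebesgue measure under f. *)
Lemma hausdorff_dim_ge A (f : R -> R) (s K : R) : 0 < s -> 0 < K ->
  (forall y, 0 <= y < 1 -> A (f y)) ->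
  (forall y y', 0 <= y < 1 -> 0 <= y' < 1 ->
     `|f y - f y'| <= 1 /\ `|y - y'| <= K * `|f y - f y'| `^ s) ->
  (s%:E <= hausdorff_dim A)%E.
Proof.
move=> s0 K0 fA fK; apply/ereal_infP => _ [t [t0 At] <-]; rewrite lee_fin leNgt.
apply/negP => ts.
have c0 : (hausdorff_content 1 t A <= 0)%E.
  by rewrite -At; apply: ereal_sup_ubound; exists 1 => //=; exact: ltr01.
(* The preimage of [U n] fits in an interval of length [2 * K * diam (U n) ^ t], so a cover of cost
   below [1 / (2 * K)] cannot pull back to a cover of [[0, 1[]. *)
have [] : exists2 U : (set R)^nat, A `<=` \bigcup_n U n /\ forall n, (diam (U n) <= 1%:E)%E &
     (\sum_(0 <= n <oo) diam (U n) `^ t < (2 * K)^-1%:E)%E.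
  have : (hausdorff_content 1 t A < (2 * K)^-1%:E)%E.
    by apply: le_lt_trans c0 _; rewrite lte_fin invr_gt0 mulr_gt0.
  by move=> /ereal_inf_lt[_ [U hU <-] ?]; exists U.
move=> U [AU U1] Ut.
pose r n := fine (diam (U n)).
have rE n : diam (U n) = (r n)%:E.
  by rewrite fineK // ge0_fin_numE ?diam_ge0 // (le_lt_trans (U1 n)) ?ltry.
have r0 n : 0 <= r n by rewrite -lee_fin -rE diam_ge0.
pose V n := [set y | 0 <= y < 1 /\ U n (f y)].
have Vr n y y' : V n y -> V n y' -> `|y - y'| <= K * r n `^ t.
  move=> [hy Uy] [hy' Uy']; have [f1 fs] := fK _ _ hy hy'.
  apply: le_trans fs _; rewrite ler_pM2l //.
  have fr : `|f y - f y'| <= r n by rewrite -lee_fin -rE le_diam.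
  apply: (@le_trans _ _ (`|f y - f y'| `^ t)); last first.
    by apply: ge0_ler_powR; rewrite ?nnegrE // ltW.
  (* For distances at most 1, lowering the exponent from [s] to [t] increases the power. *)
  have [->|fn0] := eqVneq `|f y - f y'| 0; first by rewrite !powR0 ?gt_eqF.
  by apply: ger_powR; [rewrite f1 lt_neqAle eq_sym fn0 normr_ge0|exact: ltW].
have /choice[I hI] : forall n, exists I : interval R, V n `<=` [set` I] /\
    (lebesgue_measure ([set` I] : set R) <= (2 * K)%:E * (r n `^ t)%:E)%E.
  move=> n; have [V0|/set0P[y Vy]] := eqVneq (V n) set0.
    exists `]0, 0[; split; first by rewrite V0.
    by rewrite lebesgue_measure_itv /= ltxx lee_fin mulr_ge0 ?powR_ge0 // mulr_ge0 // ltW.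
  pose d := K * r n `^ t.
  have d0 : 0 <= d by rewrite mulr_ge0 ?powR_ge0 // ltW.
  exists `[y - d, y + d]; split.
    by move=> y' Vy'; have := Vr _ _ _ Vy Vy'; rewrite /= in_itv /= ler_norml -/d; lra.
  rewrite lebesgue_measure_itv /=; case: ifP => _; rewrite -?EFinD lee_fin.
    by rewrite -mulrA -/d; lra.
  by rewrite mulr_ge0 ?powR_ge0 // mulr_ge0 // ltW.
have sub : `[0, 1[%classic `<=` \bigcup_n [set` I n].
  move=> y /=; rewrite in_itv /= => hy; have [n _ Un] := AU _ (fA _ hy).
  by exists n => //; apply: (hI n).1; split.
have : (lebesgue_measure (`[0%R, 1%R[%classic : set R) <=
    \sum_(0 <= n <oo) lebesgue_measure ([set` I n] : set R))%E.
  by apply: measure_sigma_subadditive => // n; exact: measurable_itv.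
apply/negP; rewrite -ltNge lebesgue_measure_itv /= lte_fin ltr01 oppr0 adde0.
apply: (@le_lt_trans _ _ (\sum_(0 <= n <oo) ((2 * K)%:E * (diam (U n) `^ t)))%E).
  apply: lee_nneseries => [n _ _|n _]; first exact: measure_ge0.
  by rewrite rE poweR_EFin; exact: (hI n).2.
rewrite nneseriesZl; last by move=> n _; exact: poweR_ge0.
have K2 : 0 < 2 * K by rewrite mulr_gt0.
have -> : 1%E = ((2 * K)%:E * (2 * K)^-1%:E)%E :> \bar R by rewrite -EFinM mulfV ?gt_eqF.
by rewrite lte_pmul2l.
Qed.

End HausdorffDimensionBounds.

(** * Points of the spectrum slightly above 3 *)

(** [v n] is the supremum of the finite compositions [F n], [F n.+1], ... applied to 0. Monotonicity
    and the Lipschitz bound let [F n] pass through the supremum. *)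
Lemma backward_orbit_exists (R : realType) (F : nat -> R -> R) :
  (forall n x, 0 <= x <= 1 -> 0 <= F n x <= 1) ->
  (forall n x y, 0 <= x -> x <= y -> y <= 1 -> 0 <= F n y - F n x <= y - x) ->
  exists v : nat -> R, forall n, 0 <= v n <= 1 /\ v n = F n (v n.+1).
Proof.
move=> F01 Fxy.
pose comp := fix comp n k : R := if k is k'.+1 then F n (comp n.+1 k') else 0.
have comp01 n k : 0 <= comp n k <= 1.
  by elim: k n => [|k IH] n /=; [rewrite lexx ler01|exact: F01].
pose S n := [set comp n k | k in [set: nat]].
have S_sup n : has_sup (S n).
  split; first by exists (comp n 0%N), 0%N.
  by exists 1 => _ [k _ <-]; case/andP: (comp01 n k).
have comp_le n k : comp n k <= sup (S n).
  by apply: ub_le_sup; [case: (S_sup n)|exists k].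
have sup01 n : 0 <= sup (S n) <= 1.
  rewrite (comp_le n 0%N) /=; apply: ge_sup; first by case: (S_sup n).
  by move=> _ [k _ <-]; case/andP: (comp01 n k).
exists (fun n => sup (S n)) => n; split=> //.
apply/eqP; rewrite eq_le; apply/andP; split.
  apply: ge_sup; first by case: (S_sup n).
  move=> _ [[|k] _ <-] /=; first by case/andP: (F01 n _ (sup01 n.+1)).
  have /andP[c0 c1] := comp01 n.+1 k; have /andP[s0 s1] := sup01 n.+1.
  by have := Fxy n _ _ c0 (comp_le n.+1 k) s1; lra.
apply/ler_addgt0Pr => e e0.
have [_ [k _ <-] kS] := sup_adherent e0 (S_sup n.+1).
have /andP[c0 c1] := comp01 n.+1 k; have /andP[s0 s1] := sup01 n.+1.
have := Fxy n _ _ c0 (comp_le n.+1 k) s1; have := comp_le n k.+1 => /=; lra.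
Qed.

(** * The maps prepending a run of ones *)

Section RunMaps.
Variable R : realFieldType.
Implicit Types (x y : R) (k : nat).

(* [ones_map x] is [0; 1, 1 + x] and [twos_map x] is [0; 2, 2 + x]. *)
Definition ones_map x : R := (1 + x) / (2 + x).
Definition twos_map x : R := (2 + x) / (5 + 2 * x).
(** The value of [[0; 1, ..., 1, 2, 2 + x]] with [2 k] ones; it increases with [x] because the
    number of digits is even. *)
Definition run_map k x : R := iter k ones_map (twos_map x).

Lemma iter_ones_map_ge0 k x : 0 <= x -> 0 <= iter k ones_map x.
Proof.
by move=> x0; elim: k => //= k IH; rewrite divr_ge0 //; apply: addr_ge0.
Qed.

Lemma ones_mapB x y : 0 <= x -> 0 <= y ->
  ones_map y - ones_map x = (y - x) * ((2 + x) * (2 + y))^-1.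
Proof. by move=> x0 y0; rewrite /ones_map; field; apply/andP; split; lra. Qed.

Lemma twos_mapB x y : 0 <= x -> 0 <= y ->
  twos_map y - twos_map x = (y - x) * ((5 + 2 * x) * (5 + 2 * y))^-1.
Proof. by move=> x0 y0; rewrite /twos_map; field; apply/andP; split; lra. Qed.

Lemma ones_map_bounds x : 0 <= x <= 1 -> 1/2 <= ones_map x <= 1.
Proof.
move=> x01; rewrite /ones_map ler_pdivlMr ?ler_pdivrMr; lra.
Qed.

Lemma twos_map_bounds x : 0 <= x <= 1 -> 0 <= twos_map x <= 3/7.
Proof.
move=> x01; rewrite /twos_map ler_pdivlMr ?ler_pdivrMr; lra.
Qed.

Lemma ones_map_expansion x y : 0 <= x -> x <= y -> y <= 1 ->
  (y - x) / 16 <= ones_map y - ones_map x <= (y - x) / 4.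
Proof.
move=> x0 xy y1; rewrite ones_mapB //; last lra.
have [h1 h2] : 4 <= (2 + x) * (2 + y) /\ (2 + x) * (2 + y) <= 16 by nra.
by rewrite !ler_wpM2l ?subr_ge0 ?lef_pV2 ?posrE //; lra.
Qed.

Lemma twos_map_expansion x y : 0 <= x -> x <= y -> y <= 1 ->
  (y - x) / 64 <= twos_map y - twos_map x <= (y - x) / 4.
Proof.
move=> x0 xy y1; rewrite twos_mapB //; last lra.
have [h1 h2] : 4 <= (5 + 2 * x) * (5 + 2 * y) /\ (5 + 2 * x) * (5 + 2 * y) <= 64 by nra.
by rewrite !ler_wpM2l ?subr_ge0 ?lef_pV2 ?posrE //; lra.
Qed.

Lemma iter_ones_map_bounds k x : 0 <= x <= 1 -> 0 <= iter k ones_map x <= 1.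
Proof. by move=> x01; elim: k => //= k /ones_map_bounds; lra. Qed.

Lemma iter_ones_map_expansion k x y : 0 <= x -> x <= y -> y <= 1 ->
  (y - x) / 16 ^+ k <= iter k ones_map y - iter k ones_map x <= (y - x) / 4 ^+ k.
Proof.
move=> x0 xy y1; elim: k => [|k /andP[IH1 IH2]]; first by rewrite !expr0 !divr1 !lexx.
have xb := @iter_ones_map_bounds k x ltac:(lra).
have yb := @iter_ones_map_bounds k y ltac:(lra).
have d0 : 0 <= (y - x) / 16 ^+ k by rewrite divr_ge0 ?exprn_ge0 // subr_ge0.
have /andP[h1 h2] := @ones_map_expansion (iter k ones_map x) (iter k ones_map y)
  ltac:(lra) ltac:(lra) ltac:(lra).
rewrite !exprSr !invfM !mulrA /=; lra.
Qed.

Lemma run_map_bounds k x : 0 <= x <= 1 -> 0 <= run_map k x <= 1.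
Proof. by move=> /twos_map_bounds ?; apply: iter_ones_map_bounds; lra. Qed.

Lemma run_map_expansion k x y : 0 <= x -> x <= y -> y <= 1 ->
  (y - x) / 16 ^+ k.+2 <= run_map k y - run_map k x <= (y - x) / 4.
Proof.
move=> x0 xy y1; have xb := @twos_map_bounds x ltac:(lra).
have yb := @twos_map_bounds y ltac:(lra).
have /andP[h1 h2] := twos_map_expansion x0 xy y1.
have /andP[g1 g2] := @iter_ones_map_expansion k (twos_map x) (twos_map y)
  ltac:(lra) ltac:(lra) ltac:(lra).
have p1 : 0 < 16 ^+ k :> R by rewrite exprn_gt0.
have p2 : 1 <= 4 ^+ k :> R by rewrite exprn_ege1 //; lra.
apply/andP; split.
  apply: le_trans g1; rewrite !exprS !invfM !mulrA ler_pM2r ?invr_gt0 //.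
  lra.
apply: (le_trans g2); apply: le_trans h2; rewrite ler_pdivrMr ?(lt_le_trans ltr01) //.
by rewrite ler_peMr //; lra.
Qed.

Lemma run_map_le k x y : 0 <= x -> x <= y -> y <= 1 -> run_map k x <= run_map k y.
Proof.
move=> x0 xy y1; have /andP[h _] := run_map_expansion k x0 xy y1.
by rewrite -subr_ge0; apply: le_trans h; rewrite divr_ge0 ?exprn_ge0 // subr_ge0.
Qed.

(** After [k] common steps, a value of [twos_map], at most [3/7], is compared with a value of
    [ones_map], at least [1/2]; and [1/2 - 3/7 >= 1/16]. *)
Lemma run_map_gap k k' x y : 0 <= x <= 1 -> 0 <= y <= 1 -> (k < k')%N ->
  1 / 16 ^+ k.+1 <= run_map k' y - run_map k x.
Proof.
move=> x01 y01 kk'; rewrite /run_map -(subnKC (ltnW kk')) iterD.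
have [l ->] : exists l, (k' - k = l.+1)%N by exists (k' - k).-1; lia.
have hx := twos_map_bounds x01; have hy := twos_map_bounds y01.
have hl := @iter_ones_map_bounds l (twos_map y) ltac:(lra).
have := ones_map_bounds hl; rewrite -iterS; set z := iter l.+1 _ _ => hz.
have /andP[h _] := @iter_ones_map_expansion k (twos_map x) z ltac:(lra) ltac:(lra) ltac:(lra).
apply: le_trans h; rewrite exprS invfM mulrA ler_pM2r ?invr_gt0 ?exprn_gt0 //.
lra.
Qed.

Lemma run_map_lt k k' x y : 0 <= x <= 1 -> 0 <= y <= 1 -> (k < k')%N ->
  run_map k x <= run_map k' y.
Proof.
move=> x01 y01 kk'; rewrite -subr_ge0; apply: le_trans (run_map_gap x01 y01 kk').
by rewrite divr_ge0 ?exprn_ge0.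
Qed.

Definition golden (psi : R) : Prop := 1/2 <= psi <= 1 /\ psi ^+ 2 + psi = 1.

Lemma ones_map_fixed psi : golden psi -> ones_map psi = psi.
Proof.
move=> [psi_gt psi2]; have n0 : 2 + psi != 0 by lra.
by apply: (mulIf n0); rewrite /ones_map divfK //; transitivity (psi ^+ 2 + psi + psi); [rewrite psi2|]; ring.
Qed.

Lemma run_map_golden psi k x : golden psi -> 0 <= x <= 1 ->
  0 <= psi - run_map k x <= 1 / 4 ^+ k.
Proof.
move=> gpsi x01; have hx := twos_map_bounds x01; have [psi_gt _] := gpsi.
have e : iter k ones_map psi = psi by elim: k => //= k ->; exact: ones_map_fixed.
have /andP[h1 h2] := @iter_ones_map_expansion k (twos_map x) psi ltac:(lra) ltac:(lra) ltac:(lra).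
rewrite e in h1 h2; apply/andP; split.
  by apply: le_trans h1; rewrite divr_ge0 ?exprn_ge0 //; lra.
apply: (le_trans h2); rewrite ler_wpM2r ?invr_ge0 ?exprn_ge0 //; lra.
Qed.

Lemma golden_value psi : golden psi -> 2 + (2 + psi)^-1 + psi = 3.
Proof.
move=> [psi_gt psi2]; have n0 : 2 + psi != 0 by lra.
have -> : (2 + psi)^-1 = 1 - psi.
  apply: (mulIf n0); rewrite mulVf //.
  by transitivity (2 - (psi ^+ 2 + psi)); [rewrite psi2|]; ring.
ring.
Qed.

End RunMaps.

Lemma golden_exists (R : realType) : exists psi : R, golden psi.
Proof.
exists ((Num.sqrt 5 - 1) / 2).
have s5 : Num.sqrt 5 ^+ 2 = 5 :> R by rewrite sqr_sqrtr.
have s0 : 0 <= Num.sqrt 5 :> R by exact: sqrtr_ge0.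
have h1 : 2 <= Num.sqrt 5 :> R by rewrite -[2]ger0_norm // -sqrtr_sqr ler_wsqrtr //; lra.
have h2 : Num.sqrt 5 <= 3 :> R by rewrite -[3]ger0_norm // -sqrtr_sqr ler_wsqrtr //; lra.
split; first lra.
transitivity ((Num.sqrt 5 ^+ 2 - 1) / 4 : R); first by field.
by rewrite s5; lra.
Qed.

(* Digits of a sequence made of the runs 2, 2, 1^(2 K_0), 2, 2, 1^(2 K_1), ...;
   the state (i, j) is position j of block i. *)
Section RunSequence.
Variables (R : realType) (K : nat -> nat) (rho : nat -> R).
Hypothesis K_gt0 : forall i, (0 < K i)%N.
Hypothesis rho01 : forall i, 0 <= rho i <= 1.
Hypothesis rhoE : forall i, rho i = run_map (K i) (rho i.+1).

Definition digit_next (c : nat * nat) : nat * nat :=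
  if (c.2 < (K c.1).*2.+1)%N then (c.1, c.2.+1) else (c.1.+1, 0%N).
Definition digit_state n := iter n digit_next (0%N, 0%N).
Definition run_digit (c : nat * nat) : int := if (c.2 < 2)%N then 2 else 1.
Definition run_cf (n : nat) : int := if n is n'.+1 then run_digit (digit_state n') else 0.

Fixpoint left_reading (i : nat) : R :=
  if i is i'.+1 then run_map (K i') (left_reading i') else 0.

Let e (x : R) : R := (1 + x)^-1.

Let iter_ones k x : 0 <= x -> iter k.*2 e x = iter k (@ones_map R) x.
Proof.
move=> x0; elim: k => //= k ->; rewrite /e /ones_map.
have y0 := iter_ones_map_ge0 k x0; set y := iter k _ _ in y0 *.
by field; apply/andP; split; lra.
Qed.

Let iter_e_bounds k x : 0 < x <= 1 -> 0 < iter k e x <= 1.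
Proof.
move=> x01; elim: k => //= k /andP[h1 h2].
by rewrite /e invr_gt0 invf_le1; lra.
Qed.

(** The continued fraction [[0; ...]] whose first digit is the one at state [c]; [left_value] reads
    the preceding digits backwards. *)
Definition right_value (c : nat * nat) : R :=
  match c.2 with
  | 0%N => twos_map (rho c.1)
  | 1%N => (2 + rho c.1)^-1
  | _ => iter ((K c.1).*2.+2 - c.2) e (twos_map (rho c.1.+1))
  end.

Definition left_value (c : nat * nat) : R :=
  match c.2 with
  | 0%N => left_reading c.1
  | 1%N => (2 + left_reading c.1)^-1
  | _ => iter (c.2 - 2) e (twos_map (left_reading c.1))
  end.

Lemma left_reading_bounds i : 0 <= left_reading i <= 1.
Proof. by elim: i => [|i IH] /=; [rewrite lexx ler01|exact: run_map_bounds]. Qed.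

Let twos_map_gt0 (x : R) : 0 <= x <= 1 -> 0 < twos_map x <= 1.
Proof.
move=> x01; have := twos_map_bounds x01 => h.
by rewrite /twos_map divr_gt0 /=; [move: h; rewrite /twos_map; lra|lra|lra].
Qed.

Let inv2_bounds (x : R) : 0 <= x <= 1 -> 0 < (2 + x)^-1 <= 1.
Proof. by move=> x01; rewrite invr_gt0 invf_le1; lra. Qed.

Lemma right_value_bounds c : 0 < right_value c <= 1.
Proof.
case: c => i [|[|j]]; rewrite /right_value /=.
- exact: twos_map_gt0.
- exact: inv2_bounds.
- by apply: iter_e_bounds; exact: twos_map_gt0.
Qed.

Lemma left_value_bounds c : 0 <= left_value c <= 1.
Proof.
have lb := left_reading_bounds.
case: c => i [|[|j]]; rewrite /left_value /=.
- exact: lb.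
- by have := inv2_bounds (lb i); lra.
- by have := @iter_e_bounds (j.+2 - 2) _ (twos_map_gt0 (lb i)); lra.
Qed.

Lemma twos_mapE (x : R) : 0 <= x -> twos_map x = (2 + (2 + x)^-1)^-1.
Proof. by move=> x0; rewrite /twos_map; field; do ?[apply/andP; split]; lra. Qed.

Let valid (c : nat * nat) := (c.2 < (K c.1).*2.+2)%N.

Lemma right_valueE c : valid c ->
  right_value c = ((run_digit c)%:~R + right_value (digit_next c))^-1.
Proof.
have h01 := rho01; case: c => i [|[|j]]; rewrite /valid /digit_next /run_digit /right_value /=.
- by rewrite twos_mapE //; case/andP: (h01 i).
- have -> : (1 < (K i).*2.+1)%N by have := K_gt0 i; lia.
  rewrite !subSS subn0 iter_ones -/(run_map _ _) -?rhoE //.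
  by have := twos_map_gt0 (h01 i.+1); lra.
- rewrite !subSS => jv; case: ifP => jK /=.
    by rewrite (_ : ((K i).*2 - j = ((K i).*2 - j.+1).+1)%N) ?subSS //; lia.
  by rewrite (_ : ((K i).*2 - j = 1)%N) //; lia.
Qed.

Lemma left_value_next c : valid c ->
  left_value (digit_next c) = ((run_digit c)%:~R + left_value c)^-1.
Proof.
have lb := left_reading_bounds.
case: c => i [|[|j]]; rewrite /valid /digit_next /run_digit /left_value //=.
- have -> : (1 < (K i).*2.+1)%N by have := K_gt0 i; lia.
  by rewrite /= twos_mapE //; case/andP: (lb i).
- rewrite ?subSS ?subn0 => jv; case: ifP => jK /=; first by rewrite ?subSS ?subn0.
  rewrite /run_map -iter_ones; last by have := twos_map_gt0 (lb i); lra.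
  by rewrite (_ : (K i).*2 = j.+1) //; lia.
Qed.

Lemma digit_next_valid c : valid c -> valid (digit_next c).
Proof. by rewrite /valid /digit_next; case: ifP. Qed.

Lemma digit_state_valid n : valid (digit_state n).
Proof. by elim: n => [|n IH] //; exact: digit_next_valid. Qed.

Let al n : R :=
  if n is n'.+1 then (right_value (digit_state n'))^-1 else right_value (digit_state 0).

Let right_lt1 n : right_value (digit_state n) < 1.
Proof.
rewrite right_valueE ?digit_state_valid //.
have /andP[h _] := right_value_bounds (digit_next (digit_state n)).
by rewrite /run_digit; case: ifP => _; rewrite invf_lt1; lra.
Qed.

Lemma run_cf_expansion : cf_expansion run_cf al.
Proof.
have rb n : 0 < right_value (digit_state n) by case/andP: (right_value_bounds (digit_state n)).
move=> n; split; last by rewrite /al invf_gt1 ?rb // right_lt1.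
case: n => [|n]; first by rewrite /= invrK add0r.
by rewrite /al invrK right_valueE ?digit_state_valid // invrK.
Qed.

Lemma run_cf_back n : cf_back R run_cf n = left_value (digit_state n).
Proof.
elim: n => [|n IH] //.
by rewrite [LHS]/= IH -left_value_next ?digit_state_valid.
Qed.

Let lam c := (right_value c)^-1 + left_value c.

Let lam0 i : lam (i, 0%N) = 2 + (2 + rho i)^-1 + left_reading i.
Proof. by rewrite /lam /right_value /left_value /= twos_mapE ?invrK //; case/andP: (rho01 i). Qed.

Let lam1 i : lam (i, 1%N) = 2 + rho i + (2 + left_reading i)^-1.
Proof. by rewrite /lam /right_value /left_value /= invrK. Qed.

Let lam2 i j : valid (i, j.+2) -> lam (i, j.+2) <= 3.
Proof.
move=> v; rewrite /lam right_valueE // invrK /run_digit /=.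
have := right_value_bounds (digit_next (i, j.+2)).
by have := left_value_bounds (i, j.+2); lra.
Qed.

Lemma digit_state_block_start i : exists2 n, (i <= n)%N & digit_state n = (i, 0%N).
Proof.
elim: i => [|i [n ni en]]; first by exists 0%N.
have walk j : (j < (K i).*2.+2)%N -> digit_state (n + j) = (i, j).
  elim: j => [|j IH] jK; first by rewrite addn0.
  by rewrite addnS /digit_state /= -/(digit_state _) IH 1?ltnW // /digit_next /= -ltnS jK.
exists (n + (K i).*2.+2)%N; first by lia.
by rewrite addnS /digit_state /= -/(digit_state _) walk // /digit_next /= ltnn.
Qed.

Lemma digit_state_block_mono n m : (n <= m)%N ->
  ((digit_state n).1 <= (digit_state m).1)%N.
Proof.
move=> /subnKC <-; elim: (m - n)%N => [|k IH]; first by rewrite addn0.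
rewrite addnS; apply: leq_trans IH _.
by rewrite {2}/digit_state /= -/(digit_state _) /digit_next; case: ifP => //=.
Qed.

(** Every reading past the start lies between [r] and [psi], so the value at either 2 of a pair is
    at most [2 + 1 / (2 + r) + psi], and at a 1 it is at most 3. The markers approach the bound.
    Block 0 is excluded as its left reading is 0. *)
Lemma run_sequence_lagrange (psi r : R) : golden psi -> 0 <= r <= psi ->
  (forall i, r <= rho i) -> (forall i, (0 < i)%N -> r <= left_reading i) ->
  (forall M (d : R), 0 < d ->
     exists2 i, (M <= i)%N & rho i <= r + d /\ psi - d <= left_reading i) ->
  lagrange_spectrum (2 + (2 + r)^-1 + psi).
Proof.
move=> gpsi r_psi r_rho r_left markers.
have [psi01 _] := gpsi.
have rho_psi i : rho i <= psi.
  by rewrite rhoE; have := run_map_golden (K i) gpsi (rho01 i.+1); lra.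
have left_psi i : left_reading i <= psi.
  case: i => [|i] /=; first lra.
  by have := run_map_golden (K i) gpsi (left_reading_bounds i); lra.
have inv_le (u v : R) : 0 <= u -> u <= v -> (2 + v)^-1 <= (2 + u)^-1.
  by move=> u0 uv; rewrite lef_pV2 ?posrE; lra.
set l := 2 + (2 + r)^-1 + psi.
have l3 : 3 <= l.
  rewrite -(golden_value gpsi) /l; have := @inv_le r psi ltac:(lra) ltac:(lra); lra.
exists (al 0%N); first exact: cf_irrational run_cf_expansion.
apply/eqP; rewrite eq_le; apply/andP; split.
  have [n0 _ e0] := digit_state_block_start 1.
  apply: (approx_constant_le run_cf_expansion (m := n0)); first lra.
  move=> n nn0; rewrite run_cf_back -/(lam _).
  have := digit_state_block_mono nn0; have := digit_state_valid n; rewrite e0.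
  case: (digit_state n) => i [|[|j]] v i1.
  - rewrite lam0 /l; have := left_psi i.
    by have := @inv_le r (rho i) ltac:(lra) (r_rho i); lra.
  - rewrite lam1 /l; have := rho_psi i.
    by have := @inv_le r (left_reading i) ltac:(lra) (r_left i i1); lra.
  - by apply: le_trans l3; exact: lam2.
apply/lee_subgt0Pr => d d0.
pose k := Num.max (l - d) 1.
have kl : k < l by rewrite gt_max; apply/andP; split; lra.
apply: (@le_trans _ _ k%:E); first by rewrite lee_fin le_max lexx.
apply: (approx_constant_ge run_cf_expansion); first by rewrite lt_max ltr01 orbT.
move=> M; have [i Mi [ri li]] := markers M ((l - k) / 4) ltac:(lra).
have [n ni e0] := digit_state_block_start i; exists n; first exact: leq_trans ni.
rewrite run_cf_back -/(lam _) e0 lam0.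
have /andP[q0 q1] := rho01 i.
set dd := (l - k) / 4 in ri li; have dd0 : 0 < dd by rewrite divr_gt0 // subr_gt0.
have h1 : (2 + r)^-1 - (2 + rho i)^-1 <= dd.
  rewrite inv_sub_inv; [|lra|lra].
  have h1 : 0 <= (2 + r)^-1 * (2 + rho i)^-1 <= 1.
    by rewrite mulr_ge0 ?invr_ge0 /= ?mulr_ile1 ?invr_ge0 ?invf_le1; lra.
  have h2 := r_rho i.
  rewrite mulNr -mulrN opprB; apply: (@le_trans _ _ (rho i - r)); last lra.
  by rewrite ler_piMl; lra.
have -> : k = l - 4 * dd by rewrite /dd; field.
rewrite /l; lra.
Qed.

End RunSequence.

Lemma run_orbit_exists (R : realType) (K : nat -> nat) :
  exists v : nat -> R, forall n, 0 <= v n <= 1 /\ v n = run_map (K n) (v n.+1).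
Proof.
apply: (@backward_orbit_exists R (fun n => run_map (K n))) => [n x|n x y x0 xy y1].
  exact: run_map_bounds.
have := run_map_le (K n) x0 xy y1; have := run_map_expansion (K n) x0 xy y1; lra.
Qed.

(** * Realising a prescribed target reading *)

Section Schedule.
Variables (m : nat) (b : nat -> bool).

(** The first run is strictly shorter than all later ones. As readings grow with the length of their
    first run, the target read from its start is the smallest reading. *)
Definition target_run (k : nat) : nat := if k is k'.+1 then (m + 1 + b k')%N else m.

(* For n = 0, 1, ... the runs m + 3 + n, then the first n + 1 target runs. *)
Definition schedule_next (c : nat * nat) : nat * nat :=
  if (c.2 < c.1.+1)%N then (c.1, c.2.+1) else (c.1.+1, 0%N).
Definition schedule_state i := iter i schedule_next (0%N, 0%N).
Definition schedule_run (c : nat * nat) : nat :=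
  if c.2 is t.+1 then target_run t else (m + 3 + c.1)%N.
Definition schedule i := schedule_run (schedule_state i).

Lemma target_run_le k : (m <= target_run k <= m + 2)%N.
Proof. by case: k => [|k] /=; [lia|case: (b k); lia]. Qed.

Lemma schedule_state_valid i : ((schedule_state i).2 <= (schedule_state i).1.+1)%N.
Proof.
elim: i => [|i IH] //; rewrite /schedule_state /= -/(schedule_state _) /schedule_next.
by case: ifP.
Qed.

Lemma schedule_stateS i : schedule_state i.+1 = schedule_next (schedule_state i).
Proof. by []. Qed.

Lemma schedule_walk n t i : schedule_state i = (n, 0%N) -> (t <= n.+1)%N ->
  schedule_state (i + t) = (n, t).
Proof.
move=> e; elim: t => [|t IH] tn; first by rewrite addn0.
by rewrite addnS schedule_stateS IH 1?ltnW // /schedule_next /= tn.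
Qed.

Lemma schedule_state_start n : exists2 i, (n <= i)%N & schedule_state i = (n, 0%N).
Proof.
elim: n => [|n [i ni e]]; first by exists 0%N.
exists (i + n.+1).+1; first by lia.
by rewrite schedule_stateS (schedule_walk e) // /schedule_next /= ltnn.
Qed.

Variables (R : realType) (w rho : nat -> R).
Hypothesis m_gt0 : (0 < m)%N.
Hypothesis w01 : forall k, 0 <= w k <= 1.
Hypothesis wE : forall k, w k = run_map (target_run k) (w k.+1).
Hypothesis rho01 : forall i, 0 <= rho i <= 1.
Hypothesis rhoE : forall i, rho i = run_map (schedule i) (rho i.+1).

(** The copy of the target is followed by a marker run longer than any target run, so the true
    reading lies above [w t]. Each common run shrinks the error by a factor of at least 4. *)
Lemma schedule_rho_target n t i : schedule_state i = (n, t.+1) -> (t <= n)%N ->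
  0 <= rho i - w t <= 1 / 4 ^+ (n - t).+1.
Proof.
move=> + tn; move: {2}(n - t)%N (erefl (n - t)%N) => k.
elim: k t i tn => [|k IH] t i tn ek e.
all: have /andP[w0 w1] := w01 t.+1; have /andP[r0 r1] := rho01 i.+1.
all: rewrite rhoE wE /schedule e /schedule_run /= ek.
all: have le_w : w t.+1 <= rho i.+1.
- rewrite wE rhoE; apply: run_map_lt => //.
  have -> : schedule i.+1 = (m + 3 + n.+1)%N.
    rewrite /schedule schedule_stateS e /schedule_next /=.
    by case: ifP => // h; clear -h ek; lia.
  by have := target_run_le t.+1; lia.
- have /andP[h1 h2] := run_map_expansion (target_run t) w0 le_w r1.
  have h3 := run_map_le (target_run t) w0 le_w r1.
  by rewrite expr1; lra.
- have := IH t.+1 i.+1 ltac:(lia) ltac:(lia).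
  rewrite schedule_stateS e /schedule_next /= ltnS (_ : (t < n)%N); last by lia.
  by move=> /(_ erefl) /andP[h _]; lra.
- have := IH t.+1 i.+1 ltac:(lia) ltac:(lia).
  rewrite schedule_stateS e /schedule_next /= ltnS (_ : (t < n)%N); last by lia.
  rewrite (_ : (n - t.+1 = k)%N); last by lia.
  move=> /(_ erefl) /andP[_ h].
  have /andP[h1 h2] := run_map_expansion (target_run t) w0 le_w r1.
  have h3 := run_map_le (target_run t) w0 le_w r1.
  rewrite [4 ^+ k.+2]exprSr invfM mulrA; lra.
Qed.

Lemma schedule_rho_ge i : w 0 <= rho i.
Proof.
case e : (schedule_state i) => [n [|t]]; last first.
  have := schedule_state_valid i; rewrite e /= => tn.
  case: t e tn => [|t] e tn; first by have := schedule_rho_target e (leq0n _); lra.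
  rewrite wE rhoE /schedule e /=; apply: run_map_lt => //.
  by rewrite /schedule_run /=; case: (b t); lia.
rewrite wE rhoE /schedule e /=; apply: run_map_lt => //.
by rewrite /schedule_run /=; lia.
Qed.

Lemma schedule_left_ge i : (0 < i)%N -> w 0 <= left_reading R schedule i.
Proof.
case: i => // i _; have lb := @left_reading_bounds R schedule.
rewrite wE [left_reading _ _ _]/=.
case e : (schedule_state i) => [n [|[|t]]].
- by apply: run_map_lt => //; rewrite /schedule e /schedule_run /=; lia.
(* The only tie: read backwards, the first target run is followed by a marker, which is longer than
   [target_run 1]. *)
- have -> : schedule i = target_run 0 by rewrite /schedule e.
  case: i e => [|i] e //.
  have /andP[w0 w1] := w01 1; have /andP[l0 l1] := lb i.+1.
  apply: run_map_le => //; rewrite wE /=; apply: run_map_lt => //.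
  have -> : schedule i = (m + 3 + n)%N.
    move: e; rewrite schedule_stateS /schedule /schedule_next.
    by case: (schedule_state i) => n' t' /=; case: ifP => //= _ [-> ->].
  by case: (b 0); lia.
- by apply: run_map_lt => //; rewrite /schedule e /schedule_run /=; case: (b t); lia.
Qed.

Lemma schedule_lagrange (psi : R) : golden psi -> lagrange_spectrum (2 + (2 + w 0)^-1 + psi).
Proof.
move=> gpsi; have [psi01 _] := gpsi.
have K0 i : (0 < schedule i)%N.
  rewrite /schedule /schedule_run; case: (schedule_state i) => n [|t] /=; first by lia.
  by have := target_run_le t; lia.
apply: (run_sequence_lagrange K0 rho01 rhoE) => //.
- have := run_map_golden (target_run 0) gpsi (w01 1); rewrite -wE.
  by have := w01 0; lra.
- exact: schedule_rho_ge.
- exact: schedule_left_ge.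
move=> M d d0.
have [N hN] : exists N : nat, d^-1 < N%:R.
  by exists (Num.truncn d^-1).+1; exact: truncnS_gt.
have small k : (N <= k)%N -> 1 / 4 ^+ k <= d.
  move=> Nk; rewrite div1r -[d]invrK lef_pV2 ?posrE ?invr_gt0 ?exprn_gt0 //.
  apply: (le_trans (ltW hN)); apply: (@le_trans _ _ k%:R); first by rewrite ler_nat.
  by rewrite -[4]/(4%:R) -natrX ler_nat ltnW // ltn_expl.
have [i ni e] := schedule_state_start (M + N).
exists i.+1; first by lia.
have e1 : schedule_state i.+1 = ((M + N)%N, 1%N) by rewrite schedule_stateS e.
split.
  have := schedule_rho_target e1 (leq0n _).
  by have := small (M + N - 0).+1 ltac:(lia); lra.
rewrite [left_reading _ _ _]/=.
have := run_map_golden (schedule i) gpsi (left_reading_bounds R schedule i).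
have : 1 / 4 ^+ schedule i <= d by apply: small; rewrite /schedule e /schedule_run /=; clear; lia.
lra.
Qed.

End Schedule.

(** * Separation of target readings *)

Section Separation.
Variables (R : realType) (m : nat).

Let q : R := 16 ^+ (m + 4).

Let q_ge : 16 <= q.
Proof. by rewrite /q addnS exprS ler_peMr // exprn_ege1 //; lra. Qed.

Let run_map_norm k (x y : R) : (k <= m + 2)%N -> 0 <= x <= 1 -> 0 <= y <= 1 ->
  `|x - y| / q <= `|run_map k x - run_map k y|.
Proof.
move=> km.
wlog xy : x y / x <= y => [wl x01 y01|/andP[x0 x1] /andP[y0 y1]].
  have [xy|/ltW yx] := leP x y; first exact: wl.
  by rewrite distrC [leRHS]distrC; apply: wl.
have /andP[h _] := run_map_expansion k x0 xy y1.
rewrite distrC [leRHS]distrC ger0_norm ?subr_ge0 // ger0_norm ?subr_ge0 ?run_map_le //.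
apply: le_trans h; rewrite ler_wpM2l ?subr_ge0 // lef_pV2 ?posrE ?exprn_gt0 //.
by rewrite /q ler_weXn2l //; [lra|lia].
Qed.

(** The runs of index [n + 1] differ and create a gap of at least [1 / q]. Each of the [n + 1] equal
    runs before them shrinks it by a factor of at most [q]. *)
Lemma target_separation (b b' : nat -> bool) (w w' : nat -> R) n :
  (forall k, 0 <= w k <= 1 /\ w k = run_map (target_run m b k) (w k.+1)) ->
  (forall k, 0 <= w' k <= 1 /\ w' k = run_map (target_run m b' k) (w' k.+1)) ->
  (forall i, (i < n)%N -> b i = b' i) -> b n != b' n ->
  1 / q ^+ n.+2 <= `|w 0 - w' 0|.
Proof.
move=> hw hw' bb bn.
have q0 : 0 < q by move: q_ge; lra.
have q1 : 0 < q^-1 by rewrite invr_gt0.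
suff h j : (j <= n.+1)%N -> 1 / q ^+ j.+1 <= `|w (n.+1 - j)%N - w' (n.+1 - j)%N|.
  by have := h n.+1 (leqnn _); rewrite subnn.
elim: j => [|j IH] jn.
  rewrite subn0 (hw n.+1).2 (hw' n.+1).2 expr1 /=.
  have step x y : 0 <= x <= 1 -> 0 <= y <= 1 ->
      1 / q <= run_map (m + 1 + true)%N y - run_map (m + 1 + false)%N x.
    move=> x01 y01; rewrite /= addn0 [(m + 1 + 1)%N]addn1.
    apply: le_trans (run_map_gap x01 y01 (ltnSn _)).
    rewrite ler_wpM2l // lef_pV2 ?posrE ?exprn_gt0 // /q ler_weXn2l //; [lra|lia].
  have [w01 _] := hw n.+2; have [w01' _] := hw' n.+2.
  by move: bn; case: (b n); case: (b' n) => // _; [|rewrite distrC];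
    apply: le_trans (ler_norm _); exact: step.
have -> : (n.+1 - j.+1 = n - j)%N by rewrite subSS.
have e : (n.+1 - j = (n - j).+1)%N by lia.
rewrite e in IH.
have tt : target_run m b (n - j) = target_run m b' (n - j).
  by case e' : (n - j)%N => [|i] //=; rewrite bb //; clear -e' jn; lia.
have [w01 ew] := hw (n - j)%N; have [w01' ew'] := hw' (n - j)%N.
rewrite ew ew' -tt exprSr invfM mulrA.
apply: le_trans (run_map_norm _ (hw _).1 (hw' _).1); last by case/andP: (target_run_le m b (n - j)).
by rewrite ler_pM2r // IH // ltnW.
Qed.

Lemma lagrange_value_separation (x y : R) n : 0 <= x <= 1 -> 0 <= y <= 1 ->
  1 / q ^+ n <= `|x - y| -> 1 / q ^+ n.+1 <= `|(2 + x)^-1 - (2 + y)^-1|.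
Proof.
move=> x01 y01 h; rewrite inv_sub_inv; [|lra|lra].
rewrite normrM normrN.
have hx := @inv_bounds R (2 + x) 2 3 ltac:(lra) ltac:(lra).
have hy := @inv_bounds R (2 + y) 2 3 ltac:(lra) ltac:(lra).
have p0 : 16^-1 <= (2 + x)^-1 * (2 + y)^-1.
  have : 3^-1 * 3^-1 <= (2 + x)^-1 * (2 + y)^-1 by rewrite ler_pM ?invr_ge0 //; lra.
  lra.
have -> : 1 / q ^+ n.+1 = q^-1 * (1 / q ^+ n) by rewrite exprS invfM !mul1r.
have q0 := q_ge.
have a1 : q^-1 <= 16^-1 by rewrite lef_pV2 ?posrE //; lra.
have a0 : 0 <= q^-1 by rewrite invr_ge0; lra.
have b0 : 0 <= 1 / q ^+ n by rewrite div1r invr_ge0 exprn_ge0 //; lra.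
apply: ler_pM => //; rewrite ger0_norm; lra.
Qed.

(** Since [q = 2 ^ (4 * (m + 4))], this exponent turns separation by powers of [q] into binary
    precision; it is the source of the dimension bound. *)
Lemma separation_powR n (t : R) : 1 / q ^+ n <= t ->
  2^-1 ^+ n <= t `^ (4 * (m + 4)%:R)^-1.
Proof.
move=> qt; set N := (4 * (m + 4))%N.
have -> : 4 * (m + 4)%:R = N%:R :> R by rewrite natrM.
have e : 1 / q ^+ n = (2^-1 ^+ n) ^+ N :> R.
  rewrite div1r -exprVn -exprM mulnC exprM; congr (_ ^+ _).
  rewrite /q -exprVn /N exprM; congr (_ ^+ _); rewrite !exprS expr0; lra.
rewrite [leLHS](_ : _ = (1 / q ^+ n) `^ N%:R^-1); last first.
  have h0 : 0 <= 2^-1 ^+ n :> R by rewrite exprn_ge0.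
  by rewrite e -(powR_mulrn N h0) -powRrM mulfV ?powRr1 // pnatr_eq0 /N; lia.
have q0 : 0 <= 1 / q ^+ n by rewrite divr_ge0 // exprn_ge0 //; move: q_ge; lra.
by apply: ge0_ler_powR; rewrite ?nnegrE ?invr_ge0 // (le_trans q0).
Qed.

End Separation.

(** * Binary expansions *)

Section BinaryDigits.
Variable R : realType.
Implicit Types y : R.

Definition bit y (i : nat) : bool := odd (Num.truncn (2 ^+ i.+1 * y)).

Lemma truncn_half y i : 0 <= y ->
  (Num.truncn (2 ^+ i.+1 * y))./2 = Num.truncn (2 ^+ i * y).
Proof.
move=> y0; have z0 : 0 <= 2 ^+ i * y by rewrite mulr_ge0 ?exprn_ge0.
rewrite exprS -mulrA; set z := 2 ^+ i * y in z0 *.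
have z20 : 0 <= 2 * z by rewrite mulr_ge0.
have /andP[h1 h2] := truncn_itv z0; have /andP[h3 h4] := truncn_itv z20.
set T := Num.truncn z in h1 h2 *; set T2 := Num.truncn (2 * z) in h3 h4 *.
have a1 : (T.*2 < T2.+1)%N by rewrite -(ltr_nat R) -muln2 natrM; lra.
have a2 : (T2 < T.+1.*2)%N by rewrite -(ltr_nat R) -muln2 natrM; lra.
have := odd_double_half T2; case: (odd T2) => /= e; lia.
Qed.

Lemma bit_agree y y' n : 0 <= y < 1 -> 0 <= y' < 1 ->
  (forall i, (i < n)%N -> bit y i = bit y' i) -> `|y - y'| <= 2^-1 ^+ n.
Proof.
move=> /andP[y0 y1] /andP[y0' y1'] bb.
have e : Num.truncn (2 ^+ n * y) = Num.truncn (2 ^+ n * y').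
  elim: n bb => [|n IH] bb.
    have tr z : 0 <= z < 1 -> Num.truncn (2 ^+ 0 * z) = 0%N :> nat.
      by move=> z01; rewrite expr0 mul1r; apply/truncn_def; rewrite ?mulr0n ?mulr1n.
    by rewrite !tr ?y0 ?y0'.
  rewrite -[LHS]odd_double_half -[RHS]odd_double_half !truncn_half //.
  rewrite IH; last by move=> i /ltnW; exact: bb.
  by have := bb n (ltnSn _); rewrite /bit => ->.
have p0 : 0 < 2 ^+ n :> R by rewrite exprn_gt0.
have /andP[h1 h2] : (Num.truncn (2 ^+ n * y))%:R <= 2 ^+ n * y < (Num.truncn (2 ^+ n * y)).+1%:R.
  by rewrite truncn_itv // mulr_ge0 // ltW.
have /andP[h3 h4] : (Num.truncn (2 ^+ n * y'))%:R <= 2 ^+ n * y' < (Num.truncn (2 ^+ n * y')).+1%:R.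
  by rewrite truncn_itv // mulr_ge0 // ltW.
rewrite e -natr1 in h1 h2; rewrite -natr1 in h4.
rewrite exprVn -[_^-1]mul1r ler_pdivlMr // mulrC -[X in X * _]gtr0_norm // -normrM mulrBr.
rewrite ler_norml; lra.
Qed.

End BinaryDigits.

Lemma lagrange_dim_near3_ge (R : realType) (m : nat) : (0 < m)%N ->
  (((4 * (m + 4)%:R)^-1)%:E <= lagrange_dim (3 + 2 / 4 ^+ m : R))%E.
Proof.
move=> m0; have [psi gpsi] := golden_exists R; have [psi01 _] := gpsi.
have /choice[W hW] : forall b : nat -> bool, exists w : nat -> R,
    forall k, 0 <= w k <= 1 /\ w k = run_map (target_run m b k) (w k.+1).
  by move=> b; exact: run_orbit_exists.
pose f (y : R) : R := 2 + (2 + W (bit y) 0%N)^-1 + psi.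
have W0 b : 0 <= psi - W b 0%N <= 1 / 4 ^+ m.
  by rewrite (hW b 0%N).2; apply: run_map_golden => //; case: (hW b 1%N).
(* Strictly below the threshold [3 + 2 / 4 ^ m], since [L] is cut by a strict inequality. *)
have f3 y : 3 <= f y <= 3 + 1 / 4 ^+ m.
  have [w01 _] := hW (bit y) 0%N; have h := W0 (bit y).
  rewrite -{1 2}(golden_value gpsi) /f.
  have := @inv_sub_inv R 2 (W (bit y) 0%N) psi ltac:(lra) ltac:(lra).
  have hx := @inv_bounds R (2 + W (bit y) 0%N) 1 3 ltac:(lra) ltac:(lra).
  have hy := @inv_bounds R (2 + psi) 1 3 ltac:(lra) ltac:(lra).
  rewrite invr1 in hx hy.
  set u := (2 + W _ _)^-1 in hx *; set v := (2 + psi)^-1 in hy *.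
  have uv : 0 <= u * v by rewrite mulr_ge0; lra.
  have uv1 : u * v <= 1 by rewrite mulr_ile1; lra.
  have h1 : 0 <= u * v * (psi - W (bit y) 0%N) by rewrite mulr_ge0; lra.
  have h2 : u * v * (psi - W (bit y) 0%N) <= psi - W (bit y) 0%N by rewrite ler_piMl; lra.
  lra.
have p4 : 0 < 1 / 4 ^+ m :> R by rewrite divr_gt0 ?exprn_gt0.
have p41 : 1 / 4 ^+ m <= 1 :> R.
  by rewrite div1r invf_le1 ?exprn_gt0 // exprn_ege1 //; lra.
(* If bit [n] is the first to differ, the arguments are within [2 ^ (- n)] while the images are
   separated by [1 / q ^ (n + 3)]; the factor [8 = 2 ^ 3] absorbs the shift. *)
apply: (@hausdorff_dim_ge R _ f _ 8) => //.
- move=> y _; split; last by rewrite /=; have := f3 y; lra.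
  have [rho hrho] := run_orbit_exists R (schedule m (bit y)).
  by apply: (schedule_lagrange m0 (fun k => (hW (bit y) k).1) (fun k => (hW (bit y) k).2)
    (fun i => (hrho i).1) (fun i => (hrho i).2) gpsi).
move=> y y' hy hy'; split.
  by have := f3 y; have := f3 y'; rewrite ler_norml; lra.
have [exn|nex] := pselect (exists n, bit y n != bit y' n).
  case: (ex_minnP exn) => n bn nmin.
  have agree i : (i < n)%N -> bit y i = bit y' i.
    by move=> ni; have [//|h] := eqVneq (bit y i) (bit y' i); have := nmin _ h; rewrite leqNgt ni.
  have := bit_agree hy hy' agree.
  have := target_separation (hW (bit y)) (hW (bit y')) agree bn.
  move=> /(lagrange_value_separation (hW (bit y) 0%N).1 (hW (bit y') 0%N).1).
  rewrite (_ : _^-1 - _^-1 = f y - f y'); last by rewrite /f; ring.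
  move=> /separation_powR h1 h2; apply: (le_trans h2).
  apply: (@le_trans _ _ (8 * 2^-1 ^+ n.+3)); last by rewrite ler_pM2l.
  by rewrite !exprS; lra.
have agree i : bit y i = bit y' i.
  by have [//|h] := eqVneq (bit y i) (bit y' i); exfalso; apply: nex; exists i.
have -> : y = y'.
  apply/eqP; rewrite -subr_eq0 -normr_eq0 eq_le normr_ge0 andbT; apply/ler_addgt0Pr => d d0.
  have [n hn] : exists n : nat, d^-1 < n%:R.
    by exists (Num.truncn d^-1).+1; exact: truncnS_gt.
  apply: (le_trans (bit_agree hy hy' (n := n) (fun i _ => agree i))); rewrite add0r.
  rewrite exprVn -[d]invrK lef_pV2 ?posrE ?invr_gt0 ?exprn_gt0 //.
  by apply: (le_trans (ltW hn)); rewrite -natrX ler_nat ltnW // ltn_expl.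
by rewrite subrr normr0 mulr_ge0 // powR_ge0.
Qed.

Lemma lagrange_dim_bounds (R : realType) (t : R) : (0 <= lagrange_dim t <= 1)%E.
Proof.
rewrite hausdorff_dim_ge0 /=; apply: (@hausdorff_dim_bounded R _ t) => l [[x _ xl] /= lt].
by rewrite in_itv /= (ltW lt) ltW // (lagrange_gt0 xl).
Qed.

Lemma lagrange_dim3 (R : realType) : lagrange_dim (3 : R) = 0%E.
Proof. exact/hausdorff_dim_countable/countable_lagrange_lt3. Qed.

(** * Failure of every Hölder estimate at 3 *)

Lemma bernoulli (R : realDomainType) (u : R) n : 0 <= u -> 1 + n%:R * u <= (1 + u) ^+ n.
Proof.
move=> u0; elim: n => [|n IH]; first by rewrite mul0r addr0.
have nu : 0 <= n%:R * u * u by rewrite !mulr_ge0.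
have h : (1 + n%:R * u) * (1 + u) <= (1 + u) ^+ n * (1 + u) by rewrite ler_wpM2r // addr_ge0.
by rewrite exprSr -natr1; lra.
Qed.

(** The left side decays exponentially in [m], the right side only like [1 / m]. *)
Lemma holder_gap (R : realType) (a C : R) : 0 < a ->
  exists2 m : nat, (0 < m)%N & C * (2 / 4 ^+ m) `^ a < (4 * (m + 4)%:R)^-1.
Proof.
move=> a0; wlog C0 : C / 0 < C => [wl|].
  have [m m0 h] := wl (Num.max C 1) ltac:(by rewrite lt_max ltr01 orbT).
  exists m => //; apply: le_lt_trans h; rewrite ler_wpM2r ?powR_ge0 //.
  by rewrite le_max lexx.
have one_powR r : 1 `^ r = 1 :> R by rewrite powR1.
(* The exponent is halved so that squaring Bernoulli's bound for [z ^ m] gives quadratic growth of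
   [2 ^ (a * m)], enough to beat the linear term. *)
pose z : R := 2 `^ (a / 2).
have z1 : 1 < z.
  rewrite -[ltLHS](one_powR (a / 2)) /z; apply: gt0_ltr_powR; rewrite ?nnegrE //.
  - by rewrite divr_gt0.
  - by rewrite ltr1n.
pose eta := z - 1; have eta0 : 0 < eta by rewrite subr_gt0.
(* The summand 4 gives [4 * (m + 4) <= 8 * m]; the other makes [m * eta ^ 2] exceed [8 * C]. *)
pose m := (Num.truncn (8 * C / eta ^+ 2) + 4)%N.
have m4 : 4 <= m%:R :> R by rewrite ler_nat leq_addl.
have mC : 8 * C < m%:R * eta ^+ 2.
  rewrite -ltr_pdivrMr ?exprn_gt0 //; apply: lt_le_trans (truncnS_gt _) _.
  by rewrite ler_nat /m addnS ltnS addnC leq_addl.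
exists m; first by rewrite /m addnS.
clearbody m; set A := _ `^ a.
have A0 : 0 < A by rewrite powR_gt0 // divr_gt0 // exprn_gt0.
pose Z := (z ^+ m) ^+ 2.
have ZE : Z = (2 ^+ m) `^ a.
  rewrite /Z -exprM -powR_mulrn ?powR_ge0 // /z -powRrM natrM.
  rewrite -[2 ^+ m]powR_mulrn // -powRrM; congr (_ `^ _); lra.
have AZ : A * Z <= 1.
  rewrite ZE /A -powRM ?divr_ge0 ?exprn_ge0 // -[leRHS](one_powR a).
  apply: ge0_ler_powR; rewrite ?nnegrE ?mulr_ge0 ?invr_ge0 ?exprn_ge0 ?(ltW a0) //.
  have -> : 4 ^+ m = 2 ^+ m * 2 ^+ m :> R by rewrite -exprMn -natrM.
  rewrite invfM mulrA mulfVK ?gt_eqF ?exprn_gt0 // ler_pdivrMr ?exprn_gt0 // mul1r.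
  rewrite -[leLHS]expr1 ler_weXn2l ?ler1n //.
  by rewrite -(ler_nat R); lra.
have Zge : 8 * C * m%:R < Z.
  have h1 : m%:R * eta <= z ^+ m.
    have := bernoulli m (ltW eta0); rewrite (_ : 1 + eta = z); last by rewrite /eta; ring.
    lra.
  have h2 : (m%:R * eta) ^+ 2 <= Z by rewrite lerXn2r // ?nnegrE ?mulr_ge0 ?exprn_ge0 ?powR_ge0 // ltW.
  apply: lt_le_trans h2.
  have -> : (m%:R * eta) ^+ 2 = m%:R * eta ^+ 2 * m%:R by ring.
  by rewrite ltr_pM2r //; lra.
have k0 : 0 < 4 * (m + 4)%:R :> R by rewrite mulr_gt0 // ltr0n addnS.
rewrite -[ltRHS]div1r ltr_pdivlMr //; apply: lt_le_trans AZ.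
apply: (@le_lt_trans _ _ (A * (8 * C * m%:R))); last by rewrite ltr_pM2l.
have CA : 0 <= C * A by rewrite mulr_ge0 // ltW.
have -> : A * (8 * C * m%:R) = C * A * (8 * m%:R) by ring.
by rewrite ler_wpM2l // natrD; lra.
Qed.

(** The bounds in the first part show that the dimension is finite, so [fine] in the second part
    loses no information. *)
Theorem mainTheorem2 (R : realType) :
  (forall t : R, (0 <= lagrange_dim t <= 1)%E) /\
  (forall a : R, 0 < a ->
     ~ holder_continuous a (fun t : R => fine (lagrange_dim t))).
Proof.
split=> [t|a a0 [C hC]]; first exact: lagrange_dim_bounds.
have [m m0 hm] := holder_gap C a0.
pose t : R := 3 + 2 / 4 ^+ m.
have t3 : `|t - 3| = 2 / 4 ^+ m by rewrite /t addrAC subrr add0r ger0_norm // divr_ge0 ?exprn_ge0.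
have := hC t 3; rewrite t3 lagrange_dim3 subr0 => ht.
have /andP[d0 d1] := lagrange_dim_bounds t.
have d_fin : lagrange_dim t \is a fin_num.
  by rewrite ge0_fin_numE // (le_lt_trans d1) ?ltry.
have := lagrange_dim_near3_ge R m0; rewrite -/t -(fineK d_fin) lee_fin.
have := ler_norm (fine (lagrange_dim t)); lra.
Qed.
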